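(* Let $M$ be a compact, connected real analytic manifold and let $(f,\xi)$ be a Morse pair on $M$ (not necessarily tame), with flow $\Phi^\xi$ generated by $\xi$. If the Morse flow $\Phi^\xi$ satisfies the Morse-Verdier condition, then it also satisfies the Morse-Smale condition.
   Context: **Morse pair.** With $m=\dim M$, a Morse pair $(f,\xi)$ on $M$ consists of a $C^2$ Morse function $f:M\to\mathbb R$ and a $C^2$ vector field $\xi$ such that: $\xi\cdot f<0$ away from the critical set $\mathrm{Cr}_f$; and for every critical point $p$ of index $\lambda$ there exist an open neighborhood $U_p$ of $p$, a $C^2$-diffeomorphism $\Psi:U_p\to\mathbb D^m$ onto the open unit ball in $\mathbb R^m$ and reals $\mu_1,\dots,\mu_m>0$ with $\Psi(p)=0$ and $\Psi_*\xi=\sum_{i\le\lambda}\mu_iu^i\partial_{u^i}-\sum_{j>\lambda}\mu_ju^j\partial_{u^j}$. **Unstable/stable manifolds.** For $p\in\mathrm{Cr}_f$, $W^-_p$ (resp. $W^+_p$) is the set of $x\in M$ with $\lim_{t\to-\infty}\Phi^\xi_t(x)=p$ (resp. $\lim_{t\to+\infty}\Phi^\xi_t(x)=p$). $\lambda(p)$ is the Morse index, and $M_k(\xi)=\bigcup_{\lambda(p)\le k}W^-_p$. **Gap.** For vector subspaces $U,V$ of a Euclidean space, $\delta(U,V)=\sup\{\mathrm{dist}(u,V):u\in U,|u|=1\}$ ($=0$ if $U=0$). **Verdier regularity.** $M$ is regarded as embedded in a Euclidean space $E$. For $C^2$-submanifolds $X,Y\subset E$, the pair $(X,Y)$ satisfies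 the Verdier condition at $x_0\in X$ if there are an open neighborhood $U$ of $x_0$ in $E$ and $C>0$ with $\delta(T_xX,T_yY)\le C|x-y|$ for all $x\in U\cap X$, $y\in U\cap Y$ (vacuous if $x_0\notin\overline Y$). It is Verdier regular along $X$ if this holds at every $x_0\in X$. **Verdier stratification** of $X\subset E$: a finite increasing filtration $\emptyset=F_{-1}\subset F_0\subset\dots\subset F_m=X$ by closed subsets of $X$ such that each $X_k=F_k\setminus F_{k-1}$ is a $C^2$-manifold of dimension $k$, $\overline{X_k}\setminus X_k\subset F_{k-1}$, and $(X_j,X_k)$ is Verdier regular along $X_j$ for all $j<k$. **Morse-Verdier condition**: the filtration $M_0(\xi)\subset M_1(\xi)\subset\dots\subset M_m(\xi)=M$ is a Verdier stratification. **Morse-Smale condition**: for all critical points $p,q$ with $f(p)>f(q)$, $W^-_p$ intersects $W^+_q$ transversally. *)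

(* Defs.v *)
From HB Require Import structures.
From mathcomp Require Import all_boot all_order all_algebra.
From mathcomp Require Import all_classical all_reals all_analysis.

Set Implicit Arguments.
Unset Strict Implicit.
Unset Printing Implicit Defensive.

Import Order.TTheory GRing.Theory Num.Theory.
Import numFieldNormedType.Exports.

Local Open Scope classical_set_scope.
Local Open Scope ring_scope.

(* Ambient Euclidean spaces are the types 'rV[R]_n. Their library norm is the
   sup norm, which gives the right topology and differential calculus; metric
   quantities use the Euclidean norm [enorm]. Objects living on a subset X of
   'rV[R]_n are total functions whose values off X are irrelevant. *)

Section Euclidean.
Variables (R : realType) (n : nat).
Implicit Types (u v : 'rV[R]_n) (U V : set 'rV[R]_n).

Definition enorm u : R := Num.sqrt (\sum_i u 0 i ^+ 2).

Definition edist u V : R := inf [set enorm (u - v) | v in V].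

(* U and V are meant to be linear subspaces; [sup set0 = 0] handles U = 0. *)
Definition gap U V : R := sup [set edist u V | u in [set u | U u /\ enorm u = 1]].

End Euclidean.

Section Classes.
Variable R : realType.

(* For U open and W finite-dimensional. *)
Fixpoint Ck (k : nat) (W V : normedModType R) (U : set W) (f : W -> V) : Prop :=
  match k with
  | 0 => forall x, U x -> {for x, continuous f}
  | k'.+1 => (forall x, U x -> differentiable f x) /\
             (forall v, Ck k' U ('D_v f))
  end.

Definition smoothness :=
  forall (p : nat) (V : normedModType R), set 'rV[R]_p -> ('rV[R]_p -> V) -> Prop.

Definition C2 : smoothness := fun p V => @Ck 2 'rV[R]_p V.

(* Multi-indices are functions 'I_p -> nat; the partial sums run over the cubes
   {0,...,N-1}^p, which is no restriction for absolutely convergent families. *)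
Definition power_term p (V : normedModType R) (c : ('I_p -> nat) -> V)
    (h : 'rV[R]_p) (a : 'I_p -> nat) : V :=
  (\prod_i h 0 i ^+ a i) *: c a.

Definition analytic : smoothness := fun p V U f =>
  forall a, U a -> exists c : ('I_p -> nat) -> V, exists2 r : R, 0 < r &
    forall x, ball a r x ->
      cvgn (fun N => \sum_(k : {ffun 'I_p -> 'I_N})
                       `|power_term c (x - a) (fun i => nat_of_ord (k i))|) /\
      (fun N => \sum_(k : {ffun 'I_p -> 'I_N})
                  power_term c (x - a) (fun i => nat_of_ord (k i)))
        @ \oo --> f x.

(* Regularity of a map on an arbitrary subset of a Euclidean space: local
   extendability to a map of the same class on an open set. *)
Definition regular_on (S : smoothness) p (V : normedModType R)
    (A : set 'rV[R]_p) (f : 'rV[R]_p -> V) : Prop :=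
  forall x, A x -> exists (U : set 'rV[R]_p) (g : 'rV[R]_p -> V),
    [/\ open U, U x, S p V U g & forall y, A y -> U y -> g y = f y].

Definition diffeo (S : smoothness) p q (A : set 'rV[R]_p) (B : set 'rV[R]_q)
    (phi : 'rV[R]_p -> 'rV[R]_q) (psi : 'rV[R]_q -> 'rV[R]_p) : Prop :=
  [/\ forall x, A x -> B (phi x) /\ psi (phi x) = x,
      forall y, B y -> A (psi y) /\ phi (psi y) = y,
      regular_on S A phi &
      regular_on S B psi].

End Classes.

Section Submanifolds.
Variables (R : realType) (n : nat).
Implicit Types (X Y : set 'rV[R]_n) (x v : 'rV[R]_n).

(* phi : X `&` W -> V is a coordinate chart of X around x, with inverse psi. *)
Definition chart (S : smoothness R) k X x
    (phi : 'rV[R]_n -> 'rV[R]_k) (psi : 'rV[R]_k -> 'rV[R]_n) : Prop :=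
  exists (W : set 'rV[R]_n) (V : set 'rV[R]_k),
    [/\ open W, W x, open V & diffeo S (X `&` W) V phi psi].

(* The empty set is a submanifold of every dimension. *)
Definition submanifold (S : smoothness R) k X : Prop :=
  forall x, X x -> exists phi psi, @chart S k X x phi psi.

Definition curve_in X x v (c : R -> 'rV[R]_n) : Prop :=
  exists2 e : R, 0 < e &
    [/\ @Ck R 1 R^o 'rV[R]_n (ball (0 : R) e) c,
        forall t, ball (0 : R) e t -> X (c t),
        c 0 = x & is_derive (0 : R) 1 c v].

Definition tangent X x : set 'rV[R]_n := [set v | exists c, curve_in X x v c].

(* The derivative v.h at x of a map h on X along a vector v tangent to X; it
   does not depend on the curve when X is a submanifold and h is C^1 on X. *)
Definition tderive X (V : normedModType R) (h : 'rV[R]_n -> V) x v : V :=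
  xget 0 [set d | exists2 c, curve_in X x v c & is_derive (0 : R) 1 (h \o c) d].

Definition transversal_in M X Y : Prop :=
  forall x, X x -> Y x ->
    [set v + w | v in tangent X x & w in tangent Y x] = tangent M x.

Definition verdier_at X Y x0 : Prop :=
  exists (U : set 'rV[R]_n) (C : R),
    [/\ open U, U x0, 0 < C &
        forall x y, U x -> X x -> U y -> Y y ->
          gap (tangent X x) (tangent Y y) <= C * enorm (x - y)].

Definition verdier_regular X Y : Prop := forall x0, X x0 -> verdier_at X Y x0.

(* F_{k-1}, with F_{-1} empty *)
Definition prev_level (F : nat -> set 'rV[R]_n) k : set 'rV[R]_n :=
  if k is k'.+1 then F k' else set0.

Definition stratum (F : nat -> set 'rV[R]_n) k : set 'rV[R]_n :=
  F k `\` prev_level F k.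

Definition verdier_stratification m X (F : nat -> set 'rV[R]_n) : Prop :=
  [/\ forall k, (k < m)%N -> F k `<=` F k.+1,
      F m = X,
      forall k, (k <= m)%N -> exists2 D, closed D & F k = X `&` D,
      forall k, (k <= m)%N ->
        submanifold (@C2 R) k (stratum F k) /\
        closure (stratum F k) `\` stratum F k `<=` prev_level F k &
      forall j k, (j < k)%N -> (k <= m)%N ->
        verdier_regular (stratum F j) (stratum F k)].

End Submanifolds.

Section Morse.
Variables (R : realType) (n m : nat) (M : set 'rV[R]_n).
Implicit Types (f : 'rV[R]_n -> R^o) (xi : 'rV[R]_n -> 'rV[R]_n).
Implicit Types (Phi : R -> 'rV[R]_n -> 'rV[R]_n) (p : 'rV[R]_n).

Definition critical f : set 'rV[R]_n :=
  [set p | M p /\ forall v, tangent M p v -> tderive M f p v = 0].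

Definition hessian (g : 'rV[R]_m -> R^o) (u : 'rV[R]_m) : 'M[R]_m :=
  \matrix_(i, j) 'D_(delta_mx 0 i) ('D_(delta_mx 0 j) g) u.

Definition negative_on (H : 'M[R]_m) (U : {vspace 'rV[R]_m}) : Prop :=
  forall u, u \in U -> u != 0 -> (u *m H *m u^T) 0 0 < 0.

(* maximal dimension of a subspace on which H is negative definite *)
Definition matrix_index (H : 'M[R]_m) : nat :=
  \max_(d < m.+1 | `[< exists2 U : {vspace 'rV[R]_m},
                         \dim U = d & negative_on H U >]) d.

(* At a critical point, nondegeneracy and the index do not depend on the chart
   in which the Hessian is computed. *)
Definition nondegenerate f p : Prop :=
  exists phi psi, @chart R n (@C2 R) m M p phi psi /\
    \det (hessian (f \o psi) (phi p)) != 0.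

Definition morse_index f p : nat :=
  xget 0%N [set l | exists phi psi, @chart R n (@C2 R) m M p phi psi /\
                      l = matrix_index (hessian (f \o psi) (phi p))].

Definition morse_function f : Prop :=
  regular_on (@C2 R) M f /\ forall p, critical f p -> nondegenerate f p.

Definition vector_field xi : Prop :=
  regular_on (@C2 R) M xi /\ forall x, M x -> tangent M x (xi x).

Definition unit_ball : set 'rV[R]_m := [set u | enorm u < 1].

(* [tderive M Psi x (xi x)] is the value at Psi x of the push-forward of xi by
   Psi, and (mu i) are the positive rates of the linear model. *)
Definition linearizable f xi p : Prop :=
  exists (W : set 'rV[R]_n) (Psi : 'rV[R]_n -> 'rV[R]_m)
         (psi : 'rV[R]_m -> 'rV[R]_n) (mu : 'I_m -> R),
    [/\ open W /\ W p,
        diffeo (@C2 R) (M `&` W) unit_ball Psi psi,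
        forall i, 0 < mu i,
        Psi p = 0 &
        forall x, M x -> W x ->
          tderive M Psi x (xi x) =
          \row_i (if (i < morse_index f p)%N then mu i * Psi x 0 i
                  else - (mu i * Psi x 0 i))].

Definition morse_pair f xi : Prop :=
  [/\ morse_function f, vector_field xi,
      forall x, M x -> ~ critical f x -> tderive M f x (xi x) < 0 &
      forall p, critical f p -> linearizable f xi p].

Definition is_flow xi Phi : Prop :=
  forall x, M x -> Phi 0 x = x /\
    forall t, M (Phi t x) /\ is_derive t 1 (Phi ^~ x) (xi (Phi t x)).

Definition unstable Phi p : set 'rV[R]_n :=
  [set x | M x /\ Phi t x @[t --> -oo] --> p].

Definition stable Phi p : set 'rV[R]_n :=
  [set x | M x /\ Phi t x @[t --> +oo] --> p].

Definition morse_filtration f Phi (k : nat) : set 'rV[R]_n :=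
  \bigcup_(p in [set p | critical f p /\ (morse_index f p <= k)%N])
    unstable Phi p.

Definition morse_verdier f Phi : Prop :=
  verdier_stratification m M (morse_filtration f Phi).

Definition morse_smale f Phi : Prop :=
  forall p q, critical f p -> critical f q -> f q < f p ->
    transversal_in M (unstable Phi p) (stable Phi q).

End Morse.

(* Main.v *)
Require Import Defs.
From mathcomp Require Import all_boot all_order all_algebra.
From mathcomp Require Import all_classical all_reals all_analysis.
From mathcomp Require Import ring lra.

Import Order.TTheory GRing.Theory Num.Theory.
Import numFieldNormedType.Exports.

Local Open Scope classical_set_scope.
Local Open Scope ring_scope.

Set Implicit Arguments.
Unset Strict Implicit.
Unset Printing Implicit Defensive.

(* Let x lie on W^-_p and on W^+_q, and let k, j be the indices of p and q. The
   forward orbit of x stays in the stratum X_k and tends to q, so q lies in the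
   closed set F_k and j <= k; j = k is impossible because near q the stratum X_j
   is the local unstable disc of q, which would force p = q. So the Verdier
   condition applies to (X_j, X_k) at q, and only its consequence that T_q X_j is
   almost contained in T_y X_k for y in X_k near q is used. In the linearizing
   chart the tangent space of W^+_q at a point y = Phi_t x close to q is constant,
   and it is complementary to T_q X_j, hence complementary to a subspace of
   T_y X_k = T_y W^-_p. This transversality at y is carried back to x by Phi_{-t}.

   Tangent vectors being velocities of curves, carrying them along the flow only
   requires that Phi_t maps C^1 curves to C^1 curves, with velocities depending
   additively on the velocities. Both facts follow from a single Gronwall estimate
   for linear combinations of differences of orbits, based on the second order
   Taylor estimate of the vector field, which is uniform on the compact set M. *)

(** * Matrix norms and derivatives of matrix-valued maps *)

(** The flow is controlled on [M] only, [xi] is only locally extendable, and the stable and unstable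
    sets are bare sets at [x], so no variational equation is written down. In the estimates a
    bounded matrix, chosen at each point without any continuity, plays the part of the differential
    of [xi], and pushed velocities are never computed: only their existence, continuity and
    additivity are extracted.

    All estimates survive a change of sign of [xi]. Hence local results are proved for stable sets
    alone, and reversing time gives them for unstable sets.

    That the local disc fills the stratum near a critical point is a matter of dimension; strict
    differentiability replaces the inverse function theorem there.

    Complementarity at [y] becomes a statement about one matrix: its rows are vectors of the tangent
    space of the stratum followed by the contracting axes, and it is invertible because it is close
    to the identity.

    Even the inclusion of the sum of the two tangent sets in that of [M] needs an argument at [x]:
    it too is carried back from [y], where the chart makes the tangent set of [M] a vector space. *)

Section MatrixNorm.
Variable R : realType.

Lemma mx_norm_coord m n (A : 'M[R]_(m, n)) i j : `|A i j| <= `|A|.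
Proof.
rewrite [leRHS]/Num.Def.normr/= mx_normrE.
by apply/bigmax_geP; right => /=; exists (i, j).
Qed.

Lemma mx_norm_le m n (A : 'M[R]_(m, n)) (e : R) :
  0 <= e -> (forall i j, `|A i j| <= e) -> `|A| <= e.
Proof.
move=> e0 Ae; rewrite /Num.Def.normr/= mx_normrE.
by apply: bigmax_le => // -[i j] _ /=.
Qed.

Lemma mx_norm_mul m n p (A : 'M[R]_(m, n)) (B : 'M[R]_(n, p)) :
  `|A *m B| <= n%:R * (`|A| * `|B|).
Proof.
apply: mx_norm_le => [|i j]; first by rewrite !mulr_ge0.
rewrite mxE (le_trans (ler_norm_sum _ _ _))//.
have -> : n%:R * (`|A| * `|B|) = \sum_(k < n) (`|A| * `|B|).
  by rewrite sumr_const card_ord mulr_natl.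
by apply: ler_sum => k _; rewrite normrM ler_pM ?mx_norm_coord.
Qed.

Lemma is_derive_mx_coord (V : normedModType R) m n (M : V -> 'M[R]_(m, n)) t v dM :
  is_derive t v M dM -> forall i j, is_derive t v (fun t => M t i j) (dM i j).
Proof.
move=> dMt i j; have /derivable_mxP/(_ i j) dv : derivable M t v by exact: ex_derive.
apply: DeriveDef => //.
by rewrite -(@derive_val _ _ _ _ _ _ _ dMt) derive_mx ?mxE//; exact: ex_derive.
Qed.

Lemma is_derive_mxP (V : normedModType R) m n (M : V -> 'M[R]_(m, n)) t v
    (dM : 'M[R]_(m, n)) :
  (forall i j, is_derive t v (fun t => M t i j) (dM i j)) -> is_derive t v M dM.
Proof.
move=> dMt; have dv : derivable M t v by apply/derivable_mxP => i j; apply: ex_derive.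
apply: DeriveDef => //; rewrite derive_mx//; apply/matrixP => i j; rewrite mxE.
exact: derive_val.
Qed.

Lemma is_derive_unique (V W : normedModType R) (h : V -> W) t v d1 d2 :
  is_derive t v h d1 -> is_derive t v h d2 -> d1 = d2.
Proof. by case=> _ <- [_ <-]. Qed.

Lemma is_derive_chain (V W : normedModType R) (h : V -> W) (c : R -> V) t v :
  differentiable h (c t) -> is_derive t 1 c v ->
  is_derive t 1 (h \o c) ('D_v h (c t)).
Proof.
move=> dh dc; have c1 : differentiable c t.
  by apply/derivable1_diffP; exact: ex_derive.
have hc : differentiable (h \o c) t by exact: differentiable_comp.
apply: DeriveDef; first exact/derivable1_diffP.
rewrite deriveE// diff_comp//= deriveE//; congr ('d h _ _).
by rewrite -deriveE//; exact: derive_val.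
Qed.

Lemma is_derive_line (V : normedModType R) (a w : V) t :
  is_derive t (1 : R) (fun s : R => a + s *: w) w.
Proof.
have d1 : is_diff t ( *:%R^~ w : R -> V) ( *:%R^~ w) by exact: is_diff_scalel.
have d2 : is_derive t 1 ( *:%R^~ w : R -> V) w.
  apply: DeriveDef; first by apply/derivable1_diffP; exact: ex_diff.
  by rewrite deriveE ?diff_val ?scale1r//; exact: ex_diff.
have := is_deriveD (is_derive_cst a t (1:R)) d2.
by rewrite add0r.
Qed.

End MatrixNorm.

(** * Taylor estimates for C^2 maps *)

Lemma ler_sum2 (R : realType) (I J : finType) (F : I -> J -> R) i j :
  (forall i j, 0 <= F i j) -> F i j <= \sum_i \sum_j F i j.
Proof.
move=> F0; rewrite (bigD1 i)//= (bigD1 j)//= -addrA lerDl addr_ge0//.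
  by apply: sumr_ge0.
by apply: sumr_ge0 => *; apply: sumr_ge0.
Qed.

Lemma mx_subE (V : zmodType) m n (A B : 'M[V]_(m, n)) i j :
  (A - B) i j = A i j - B i j.
Proof. by rewrite !mxE. Qed.

Section C2Calculus.
Variables (R : realType) (p q : nat).
Implicit Types (g : 'rV[R]_p -> 'rV[R]_q) (U : set 'rV[R]_p).

Lemma jacobianE g x i j : differentiable g x ->
  'J g x i j = 'D_(delta_mx 0 i) g x 0 j.
Proof.
move=> dg; rewrite deriveEjacobian//.
by rewrite -rowE [RHS]mxE.
Qed.

(** One coordinate at a time, because the intermediate point depends on the coordinate. The bound on
    [c - a] later turns a Lipschitz Jacobian into a quadratic remainder. *)
Lemma mean_value_coord g x d a b i :
  (forall y, ball x d y -> differentiable g y) -> ball x d a -> ball x d b ->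
  exists2 c, ball x d c /\ `|c - a| <= `|b - a| &
    g b 0 i - g a 0 i = ((b - a) *m 'J g c) 0 i.
Proof.
move=> dg xa xb; pose l (t : R) := a + t *: (b - a).
have xl t : 0 <= t <= 1 -> ball x d (l t).
  move=> /andP[t0 t1]; rewrite -ball_normE/=.
  move: xa xb; rewrite -!ball_normE/= => xa xb.
  have -> : x - l t = (1 - t) *: (x - a) + t *: (x - b).
    rewrite /l scalerBl scale1r !scalerBr; apply/matrixP => u v; rewrite !mxE; ring.
  rewrite (le_lt_trans (ler_normD _ _))// !normrZ !ger0_norm ?subr_ge0//.
  have [->|t1'] := eqVneq t 1; first by rewrite subrr mul0r add0r mul1r.
  have {t1'} t1' : t < 1 by rewrite lt_neqAle t1' t1.
  have : (1 - t) * `|x - a| < (1 - t) * d by rewrite ltr_pM2l// subr_gt0.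
  have : t * `|x - b| <= t * d by rewrite ler_wpM2l// ltW.
  by move=> h1 h2; have := ltr_leD h2 h1; rewrite -mulrDl subrK mul1r.
have dl (t : R) : 0 <= t <= 1 ->
    is_derive t 1 (fun s => g (l s) 0 i) (((b - a) *m 'J g (l t)) 0 i).
  move=> t01; have gl : differentiable g (l t) by apply/dg/xl.
  rewrite -deriveEjacobian//.
  exact: is_derive_mx_coord (is_derive_chain gl (is_derive_line a (b - a) t)) 0 i.
have [|s|t t01] := @MVT_segment R (fun s => g (l s) 0 i)
    (fun t => ((b - a) *m 'J g (l t)) 0 i) 0 1 ler01.
- by move=> t; rewrite in_itv/= => /andP[t0 t1]; apply: dl; rewrite !ltW.
- apply: derivable_within_continuous => t; rewrite in_itv/= => t01.
  by have := dl t t01 => ?; exact: ex_derive.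
rewrite subr0 mulr1 /l scale1r scale0r addr0 (addrC a) subrK => ->.
move: t01; rewrite in_itv/= => t01.
exists (l t); last by [].
split; first exact: xl.
rewrite /l [_ - a]addrC addKr normrZ ler_piMl//.
by move: t01 => /andP[t0 t1]; rewrite ger0_norm.
Qed.

(** Continuity bounds the second partials near [x]; the mean value theorem applied to the first
    partials makes the Jacobian Lipschitz, and applied to [g] it gives the remainder. The centre [a]
    is free in the ball, as the compactness argument requires. *)
Lemma C2_taylor U g x : open U -> U x -> @C2 R p _ U g ->
  exists d K : R, [/\ 0 < d, 0 <= K, ball x d `<=` U &
    forall a b, ball x d a -> ball x d b ->
      `|'J g b - 'J g a| <= K * `|b - a| /\
      `|g b - g a - (b - a) *m 'J g a| <= K * `|b - a| ^+ 2].
Proof.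
move=> oU Ux [dg ddg].
pose D (j l : 'I_p) := 'D_(delta_mx 0 j) ('D_(delta_mx 0 l) g).
pose B := \sum_j \sum_l (`|D j l x| + 1).
have DB : \forall y \near x, forall j l, `|D j l y| <= B.
  apply: (@filter_forall _ _ (fun j y => forall l, `|D j l y| <= B) (nbhs x) _) => j.
  apply: (@filter_forall _ _ (fun l y => `|D j l y| <= B) (nbhs x) _) => l.
  have /cvg_norm cD : D j l y @[y --> x] --> D j l x.
    by have [_ /(_ (delta_mx 0 j) x Ux)] := ddg (delta_mx 0 l).
  have : \forall y \near x, `|D j l y| < `|D j l x| + 1.
    by apply: (cvgr_lt _ cD); rewrite ltrDl.
  apply: filterS => y /ltW /le_trans; apply.
  apply: (@ler_sum2 R _ _ (fun j l => `|D j l x| + 1)) => j' l'.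
  exact: addr_ge0 (normr_ge0 _) ler01.
have B0 : 0 <= B by apply: sumr_ge0 => *; apply: sumr_ge0 => *; exact: addr_ge0.
have UB : nbhs x (U `&` [set y | forall j l, `|D j l y| <= B]).
  by apply: filterI => //; exact: open_nbhs_nbhs.
move/nbhs_ballP : UB => [d /= d0 xd].
have J_lip a b : ball x d a -> ball x d b ->
    `|'J g b - 'J g a| <= p%:R * B * `|b - a|.
  move=> xa xb; apply: mx_norm_le => [|l i]; first by rewrite !mulr_ge0.
  have [[Ua _] [Ub _]] := (xd _ xa, xd _ xb).
  have [Eb Ea] := (jacobianE l i (dg b Ub), jacobianE l i (dg a Ua)).
  rewrite mx_subE (congr2 (fun u v : R => u - v) Eb Ea).
  have ddl y : ball x d y -> differentiable ('D_(delta_mx 0 l) g) y.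
    by move=> xy; have [h _] := ddg (delta_mx 0 l); apply: h; have [] := xd _ xy.
  have [c [xc ca] ->] := mean_value_coord i ddl xa xb.
  rewrite mxE (le_trans (ler_norm_sum _ _ _))//.
  have -> : p%:R * B * `|b - a| = \sum_(k < p) (`|b - a| * B).
    by rewrite sumr_const card_ord -mulr_natl; ring.
  apply: ler_sum => k _; rewrite normrM ler_pM ?mx_norm_coord//.
  rewrite (jacobianE _ _ (ddl _ xc)).
  by rewrite (le_trans (mx_norm_coord _ _ _))//; have [_] := xd _ xc; apply.
(* The extra factor [p] in the second entry is the price of [mx_norm_mul]. *)
exists d, (Num.max (p%:R * B) (p%:R * (p%:R * B))); split => //.
- by rewrite le_max mulr_ge0.
- by move=> y /xd [].
move=> a b xa xb; split.
  by rewrite (le_trans (J_lip _ _ xa xb))// ler_wpM2r// le_max lexx.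
rewrite (@le_trans _ _ (p%:R * (p%:R * B) * `|b - a| ^+ 2))//; last first.
  by rewrite ler_wpM2r// ?sqr_ge0// le_max lexx orbT.
apply: mx_norm_le => [|i0 i]; first by rewrite !mulr_ge0// sqr_ge0.
rewrite (ord1 i0).
have dg' y : ball x d y -> differentiable g y.
  by move=> xy; apply: dg; have [] := xd _ xy.
have [c [xc ca] E] := mean_value_coord i dg' xa xb.
have -> : (g b - g a - (b - a) *m 'J g a) 0 i =
    ((b - a) *m ('J g c - 'J g a)) 0 i.
  by rewrite mulmxBr mxE [X in X + _]mxE [in X in X + _]mxE [in RHS]mxE -E !mxE.
rewrite (le_trans (mx_norm_coord _ _ _))// (le_trans (mx_norm_mul _ _))//.
rewrite -mulrA ler_wpM2l// expr2 mulrA [in leRHS]mulrC ler_wpM2l//.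
by rewrite (le_trans (J_lip _ _ xa xc))// ler_wpM2l// mulr_ge0.
Qed.

End C2Calculus.

(** * C^1 curves in subsets of Euclidean spaces *)

Section MatrixConvergence.
Variables (R : realType) (T : Type) (F : set_system T) (FF : Filter F).

Lemma cvg_mx_coordP m n (A : T -> 'M[R]_(m, n)) (L : 'M[R]_(m, n)) :
  A t @[t --> F] --> L <-> forall i j, A t i j @[t --> F] --> L i j.
Proof.
split=> [AL i j|AL].
  exact: (cvg_comp _ _ AL (@coord_continuous R m n i j L)).
apply/cvgrPdist_le => e e0.
have : \forall t \near F, forall i j, `|L i j - A t i j| <= e.
  apply: (@filter_forall _ _ (fun i t => forall j, `|L i j - A t i j| <= e) F _) => i.
  apply: (@filter_forall _ _ (fun j t => `|L i j - A t i j| <= e) F _) => j.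
  by have /cvgrPdist_le := AL i j; apply.
apply: filterS => t Lt; apply: mx_norm_le => [|i j]; first exact: ltW.
by rewrite !mxE.
Qed.

Lemma cvg_mulmx m n p (A : T -> 'M[R]_(m, n)) (B : T -> 'M[R]_(n, p))
    (A0 : 'M[R]_(m, n)) (B0 : 'M[R]_(n, p)) :
  A t @[t --> F] --> A0 -> B t @[t --> F] --> B0 ->
  A t *m B t @[t --> F] --> A0 *m B0.
Proof.
move=> /cvg_mx_coordP AA /cvg_mx_coordP BB; apply/cvg_mx_coordP => i j.
rewrite mxE; under eq_cvg do rewrite mxE.
have -> : (fun t => \sum_k A t i k * B t k j) = \sum_k (fun t => A t i k * B t k j).
  by apply/funext => t; rewrite fct_sumE.
apply: (big_ind2 (fun f (l : R) => f @ F --> l)) => [|f1 l1 f2 l2 h1 h2|k _].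
- exact: cvg_cst.
- exact: cvgD.
- exact: cvgM.
Qed.

Lemma cvg_of_norm_le (V : normedModType R) (A : T -> V) A0 (b : T -> R) K :
  (\forall t \near F, `|A t - A0| <= K * b t) -> b t @[t --> F] --> (0 : R) ->
  A t @[t --> F] --> A0.
Proof.
move=> Ab b0; apply/subr_cvg0/norm_cvg0P.
apply: (@squeeze_cvgr _ _ _ _ (fun=> 0) (fun t => K * b t)).
- by apply: filterS Ab => t ->; rewrite normr_ge0.
- exact: cvg_cst.
- by rewrite -[X in _ --> X](mulr0 K); exact: cvgMl_tmp.
Qed.

End MatrixConvergence.

Section Curves.
Variable R : realType.

Lemma near_norm_lt (t r : R) : `|t| < r -> \forall s \near t, `|s| < r.
Proof.
exact: (@cvgr_lt _ _ _ _ (fun s : R => `|s|) `|t| (cvg_norm cvg_id) r).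
Qed.

(** On the line ['D_w c] is [w *: 'D_1 c], so the demand of [Ck] on all directions reduces to
    direction 1. *)
Lemma curve_inP n (X : set 'rV[R]_n) x v (c : R -> 'rV[R]_n) :
  curve_in X x v c <-> exists2 e : R, 0 < e &
    [/\ forall t : R, `|t| < e -> derivable c t 1,
        forall t : R, `|t| < e -> {for t, continuous ('D_1 c)},
        forall t : R, `|t| < e -> X (c t), c 0 = x & is_derive (0 : R) 1 c v].
Proof.
split=> -[e e0 [H1 H2 H3]].
  exists e => //; case: H1 => Ha Hb; split=> // t te.
  - by apply/derivable1_diffP/Ha; rewrite -ball_normE/= sub0r normrN.
  - by apply: Hb; rewrite -ball_normE/= sub0r normrN.
  - by apply: H2; rewrite -ball_normE/= sub0r normrN.
move=> c0 dc; exists e => //; split=> //.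
- split=> [t|w t]; rewrite -ball_normE/= sub0r normrN => te.
    by apply/derivable1_diffP/H1.
  have cZ : {for t, continuous (fun s => w *: 'D_1 c s)}.
    exact: (cvgZl_tmp (H2 t te)).
  have Dw s : `|s| < e -> w *: 'D_1 c s = 'D_w c s.
    move=> /H1 /derivable1_diffP ds.
    rewrite (deriveE (w : R^o) ds) (deriveE (1 : R^o) ds) -linearZ/=.
    by congr ('d c s _); rewrite /GRing.scale/= mulr1.
  have nt : \forall s \near t, w *: 'D_1 c s = 'D_w c s.
    by apply: filterS (near_norm_lt te) => s /Dw.
  rewrite /prop_for/continuous_at -Dw//.
  by apply: cvg_trans cZ; exact: near_eq_cvg.
- by move=> t; rewrite -ball_normE/= sub0r normrN => /H3.
Qed.

Lemma curve_in_continuous n (X : set 'rV[R]_n) x v c :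
  curve_in X x v c -> {for 0, continuous c}.
Proof.
move=> /curve_inP[e e0 [dc _ _ _ _]]; apply: differentiable_continuous.
by apply/derivable1_diffP/dc; rewrite normr0.
Qed.

(* [J y] is the Jacobian matrix at [y] of a C^2 extension of [h] to a
   neighbourhood of [x]; off [A] nothing is said about [h] itself. *)
Definition jet p q (A : set 'rV[R]_p) (h : 'rV[R]_p -> 'rV[R]_q)
    (x : 'rV[R]_p) (d K : R) (J : 'rV[R]_p -> 'M[R]_(p, q)) : Prop :=
  [/\ 0 < d, 0 <= K,
    forall a b, ball x d a -> ball x d b -> `|J b - J a| <= K * `|b - a|,
    forall a b, ball x d a -> ball x d b -> A a -> A b ->
      `|h b - h a - (b - a) *m J a| <= K * `|b - a| ^+ 2 &
    forall (c : R -> 'rV[R]_p) (t : R) (v : 'rV[R]_p), ball x d (c t) ->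
      (\forall s \near t, A (c s)) -> is_derive t 1 c v ->
      is_derive t 1 (h \o c) (v *m J (c t))].

Lemma regular_jet p q (A : set 'rV[R]_p) (h : 'rV[R]_p -> 'rV[R]_q) x :
  regular_on (@C2 R) A h -> A x -> exists d K J, jet A h x d K J.
Proof.
move=> hA /hA [U [g [oU Ux Cg gh]]].
have [d [K [d0 K0 xdU xd]]] := C2_taylor oU Ux Cg.
exists d, K, (jacobian g); split=> // [a b xa xb|a b xa xb Aa Ab|c t v xct Act dc].
- by have [] := xd a b xa xb.
- by rewrite -!gh//; [have [] := xd a b xa xb|exact: xdU|exact: xdU].
- have Ug : U (c t) by exact: xdU.
  have dg : differentiable g (c t) by have [+ _] := Cg; apply.
  apply: (@near_eq_is_derive _ _ _ (g \o c)); last first.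
    by rewrite -deriveEjacobian//; exact: is_derive_chain.
  have cc : c s @[s --> t] --> c t.
    by apply: differentiable_continuous; apply/derivable1_diffP; exact: ex_derive.
  have Uc : \forall s \near t, U (c s) by apply: cc; exact: open_nbhs_nbhs.
  by near=> s; apply: gh; near: s.
Unshelve. all: by end_near. Qed.

(** At every small time the composite has velocity ['D_1 c t *m J (c t)], continuous because [J] is
    Lipschitz. The interval is shrunk to keep [c] in the ball of the jet. *)
Lemma curve_comp p q (A : set 'rV[R]_p) (B : set 'rV[R]_q)
    (h : 'rV[R]_p -> 'rV[R]_q) x d K J y v c : jet A h x d K J ->
  (forall z, A z -> B (h z)) ->
  ball x d y -> curve_in A y v c -> curve_in B (h y) (v *m J y) (h \o c).
Proof.
move=> [d0 _ JK _ dh] AB xy cA; have c0c := curve_in_continuous cA.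
move: cA => /curve_inP[e e0 [dc D1c Ac c0 dc0]]; apply/curve_inP.
have xd0 : open_nbhs y (ball x d) by split => //; exact: ball_open.
have /nbhs_ballP[e' /= e'0 xe'] : nbhs 0 (c @^-1` ball x d).
  by apply: c0c; rewrite c0; exact: open_nbhs_nbhs.
exists (Num.min e e'); first by rewrite lt_min e0.
have xc (t : R) : `|t| < Num.min e e' -> ball x d (c t).
  rewrite lt_min => /andP[_ te]; apply: xe'.
  by rewrite -ball_normE/= sub0r normrN.
have te (t : R) : `|t| < Num.min e e' -> `|t| < e by rewrite lt_min => /andP[].
have dhc (t : R) : `|t| < Num.min e e' ->
    is_derive t 1 (h \o c) ('D_1 c t *m J (c t)).
  move=> tm; have dct := derivableP (dc _ (te _ tm)).
  apply: dh => //; first exact: xc.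
  by apply: filterS (near_norm_lt (te _ tm)) => s /Ac.
split.
- by move=> t /dhc ?; exact: ex_derive.
- move=> t tm.
  have nt : \forall s \near t, 'D_1 c s *m J (c s) = 'D_1 (h \o c) s.
    by apply: filterS (near_norm_lt tm) => s /dhc ?; rewrite derive_val.
  have cct : {for t, continuous c}.
    by apply: differentiable_continuous; exact/derivable1_diffP/dc/te.
  rewrite /prop_for/continuous_at -(nbhs_singleton nt).
  apply: cvg_trans (near_eq_cvg nt) _.
  apply: cvg_mulmx; first exact: (D1c _ (te _ tm)).
  apply: (@cvg_of_norm_le _ _ _ _ _ _ _ (fun s => `|c s - c t|) K).
    by apply: filterS (near_norm_lt tm) => s sm; apply: JK; exact: xc.
  by apply/norm_cvg0P/subr_cvg0.
- by move=> t tm; exact/AB/Ac/te.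
- by rewrite /= c0.
- rewrite -c0; apply: dh; rewrite ?c0//.
  have : `|0 : R| < e by rewrite normr0.
  by move=> /near_norm_lt; apply: filterS => s /Ac.
Qed.

End Curves.

(** * Tangent sets and their description in a chart *)

Section Tangents.
Variable R : realType.

Lemma regular_cvg p q (A : set 'rV[R]_p) (h : 'rV[R]_p -> 'rV[R]_q) x
    (I : Type) (F : set_system I) (FF : Filter F) (c : I -> 'rV[R]_p) :
  regular_on (@C2 R) A h -> A x -> (\forall i \near F, A (c i)) ->
  c i @[i --> F] --> x -> h (c i) @[i --> F] --> h x.
Proof.
move=> hA Ax Ac cx; have [U [g [oU Ux Cg gh]]] := hA x Ax.
have Uc : \forall i \near F, U (c i) by apply: cx; exact: open_nbhs_nbhs.
have gx : {for x, continuous g}.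
  by apply: differentiable_continuous; have [+ _] := Cg; apply.
have gc : g (c i) @[i --> F] --> g x by exact: cvg_comp cx gx.
rewrite -gh//; apply: cvg_trans gc; apply: near_eq_cvg.
by apply: filterS2 Ac Uc => i Ai Ui; rewrite gh.
Qed.

Lemma curve_in_sub n (X Y : set 'rV[R]_n) x v c :
  X `<=` Y -> curve_in X x v c -> curve_in Y x v c.
Proof.
move=> XY [e e0 [c1 Xc c0 dc]]; exists e => //; split=> // t te.
exact/XY/Xc.
Qed.

Lemma curve_in_near n (X Y : set 'rV[R]_n) x v c :
  (\forall s \near 0, Y (c s)) -> curve_in X x v c ->
  curve_in (X `&` Y) x v c.
Proof.
move=> /nbhs_ballP[r /= r0 rY] /curve_inP[e e0 [dc D1c Xc c0 dc0]].
apply/curve_inP; exists (Num.min e r); first by rewrite lt_min e0.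
split=> // t; rewrite lt_min => /andP[te tr].
- exact: dc.
- exact: D1c.
- by split; [exact: Xc|apply: rY; rewrite -ball_normE/= sub0r normrN].
Qed.

Lemma curve_in_open n (X W : set 'rV[R]_n) x v c :
  open W -> W x -> curve_in X x v c -> curve_in (X `&` W) x v c.
Proof.
move=> oW Wx cX; apply: curve_in_near (cX).
have cc := curve_in_continuous cX; apply: cc.
by have [e _ [_ _ -> _]] := cX; exact: open_nbhs_nbhs.
Qed.

Lemma curve_in_line n (V : set 'rV[R]_n) u v :
  open V -> V u -> curve_in V u v (fun s : R => u + s *: v).
Proof.
move=> oV Vu; rewrite -(setTI V); apply: curve_in_open => //.
apply/curve_inP; exists 1 => //; split=> //.
- by move=> t _; have ? := is_derive_line u v t; exact: ex_derive.
- move=> t _.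
  have -> : 'D_1 (fun s : R => u + s *: v) = cst v.
    apply/funext => s; have ? := is_derive_line u v s; exact: derive_val.
  exact: cst_continuous.
- by rewrite scale0r addr0.
- exact: is_derive_line.
Qed.

Lemma curve_in_derive n (X : set 'rV[R]_n) x v c :
  curve_in X x v c -> is_derive (0 : R) 1 c v.
Proof. by case=> e _ []. Qed.

Lemma tangent_sub n (X Y : set 'rV[R]_n) x :
  X `<=` Y -> tangent X x `<=` tangent Y x.
Proof. by move=> XY v [c cX]; exists c; exact: curve_in_sub cX. Qed.

Lemma tangent0 n (X : set 'rV[R]_n) x : X x -> tangent X x 0.
Proof.
move=> Xx; exists (cst x); apply/curve_inP; exists 1 => //; split=> //.
- move=> t _; have -> : 'D_1 (cst x) = cst 0 :> (R -> 'rV[R]_n).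
    by apply/funext => s; rewrite derive_cst.
  exact: cst_continuous.
- exact: is_derive_cst.
Qed.

Section Chart.
Variables (n k : nat) (X W : set 'rV[R]_n) (V : set 'rV[R]_k).
Variables (phi : 'rV[R]_n -> 'rV[R]_k) (psi : 'rV[R]_k -> 'rV[R]_n).
Hypotheses (oW : open W) (oV : open V).
Hypothesis phipsi : diffeo (@C2 R) (X `&` W) V phi psi.

Variables (x : 'rV[R]_n) (d K : R) (P : 'rV[R]_n -> 'M[R]_(n, k)).
Variables (u : 'rV[R]_k) (d' K' : R) (Q : 'rV[R]_k -> 'M[R]_(k, n)).
Hypotheses (jphi : jet (X `&` W) phi x d K P) (jpsi : jet V psi u d' K' Q).

Variable y : 'rV[R]_n.
Hypotheses (Xy : X y) (Wy : W y) (xy : ball x d y) (uy : ball u d' (phi y)).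

(** Images of straight lines of [V] realize these velocities; together with [chart_tangentE] this
    makes the tangent set the row space of [Q (phi y)]. *)
Lemma chart_tangent_image v : tangent X y (v *m Q (phi y)).
Proof.
have [phiV psiX _ _] := phipsi.
have [Vy yE] := phiV _ (conj Xy Wy).
have cl := curve_in_line v oV Vy.
have psiX' z : V z -> X (psi z) by move=> /psiX[[]].
have := curve_comp jpsi psiX' uy cl; rewrite yE => cX.
by eexists; exact: cX.
Qed.

(** The curve [psi \o (phi \o c)] equals [c] near 0; its velocity is computed in both ways. *)
Lemma chart_tangentE w : tangent X y w -> w = w *m P y *m Q (phi y).
Proof.
move=> [c cX]; have [phiV psiX _ _] := phipsi.
have cXW := curve_in_open oW Wy cX.
have phiV' z : (X `&` W) z -> V (phi z) by move=> /phiV[].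
have c1 := curve_comp jphi phiV' xy cXW.
have psiX' z : V z -> X (psi z) by move=> /psiX[[]].
have /curve_in_derive dc2 := curve_comp jpsi psiX' uy c1.
have : is_derive (0 : R) 1 (psi \o (phi \o c)) w.
  apply: near_eq_is_derive (curve_in_derive cX).
  move/curve_inP: cXW => [e e0 [_ _ XWc _ _]].
  have : `|0 : R| < e by rewrite normr0.
  move=> /near_norm_lt; apply: filterS => s /XWc /phiV[_] /= E.
  by rewrite E.
move=> dc3.
exact: is_derive_unique dc3 dc2.
Qed.

Lemma chart_jet_inv (v : 'rV[R]_k) : v *m Q (phi y) *m P y = v.
Proof.
have [phiV psiX _ _] := phipsi.
have [Vy yE] := phiV _ (conj Xy Wy).
have cl := curve_in_line v oV Vy.
have psiXW z : V z -> (X `&` W) (psi z) by move=> /psiX[].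
have := curve_comp jpsi psiXW uy cl; rewrite yE => cX.
have phiV' z : (X `&` W) z -> V (phi z) by move=> /phiV[].
have /curve_in_derive dc2 := curve_comp jphi phiV' xy cX.
have : is_derive (0 : R) 1 (phi \o (psi \o (fun s : R => phi y + s *: v))) v.
  apply: near_eq_is_derive (is_derive_line (phi y) v 0).
  move/curve_inP: cl => [e e0 [_ _ Vc _ _]].
  have : `|0 : R| < e by rewrite normr0.
  move=> /near_norm_lt; apply: filterS => s /Vc /psiX[_] /= E.
  by rewrite E.
move=> dc3.
exact: is_derive_unique dc2 dc3.
Qed.

End Chart.

Lemma submanifold_tangent_lin n k (X : set 'rV[R]_n) y :
  submanifold (@C2 R) k X -> X y ->
  forall a v w, tangent X y v -> tangent X y w -> tangent X y (a *: v + w).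
Proof.
move=> Xk Xy; have [phi [psi [W [V [oW Wy oV phipsi]]]]] := Xk _ Xy.
have [phiV _ rphi rpsi] := phipsi; have [Vy _] := phiV _ (conj Xy Wy).
have [d [K [P jphi]]] := regular_jet rphi (conj Xy Wy).
have [d' [K' [Q jpsi]]] := regular_jet rpsi Vy.
have [[d0 _ _ _ _] [d'0 _ _ _ _]] := (jphi, jpsi).
have yy := ballxx y d0; have uu := ballxx (phi y) d'0.
move=> a v w Tv Tw.
rewrite (chart_tangentE oW phipsi jphi jpsi Wy yy uu Tv).
rewrite (chart_tangentE oW phipsi jphi jpsi Wy yy uu Tw).
rewrite scalemxAl -mulmxDl.
exact: (chart_tangent_image oV phipsi jpsi Xy Wy uu).
Qed.

Lemma submanifold_tangent_sum n k (X : set 'rV[R]_n) y (I : finType)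
    (a : I -> R) (w : I -> 'rV[R]_n) :
  submanifold (@C2 R) k X -> X y -> (forall i, tangent X y (w i)) ->
  tangent X y (\sum_i a i *: w i).
Proof.
move=> Xk Xy Tw; apply: (big_rec (tangent X y)); first exact: tangent0.
by move=> i z _ Tz; exact: (submanifold_tangent_lin Xk Xy).
Qed.

End Tangents.

(** * Gronwall estimates *)

Section Gronwall.
Variable R : realType.

Lemma derive_le0_le (f f' : R -> R) (T : R) : 0 <= T ->
  (forall t, 0 <= t <= T -> is_derive t 1 f (f' t) /\ f' t <= 0) -> f T <= f 0.
Proof.
move=> T0 df; have [||t] := @MVT_segment R f f' 0 T T0.
- move=> t; rewrite in_itv/= => /andP[t0 tT].
  have t0T : 0 <= t <= T by rewrite !ltW.
  by have [] := df t t0T.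
- apply: derivable_within_continuous => t; rewrite in_itv/= => t0T.
  by have [? _] := df t t0T; exact: ex_derive.
rewrite in_itv/= subr0 => /df[_ ft0] E.
by rewrite -subr_le0 E mulr_le0_ge0.
Qed.

(** The squared Euclidean norm is differentiable along curves, which the sup norm is not; the
    comparison of the two costs factors [n]. *)
Definition sqnorm n (w : 'rV[R]_n) : R := \sum_i w 0 i ^+ 2.

Lemma sqnorm_ge n (w : 'rV[R]_n) : `|w| ^+ 2 <= sqnorm w.
Proof.
have s0 : 0 <= sqnorm w by apply: sumr_ge0 => i _; exact: sqr_ge0.
rewrite -[leRHS]sqr_sqrtr// ler_sqr ?nnegrE ?sqrtr_ge0//.
apply: mx_norm_le => [|i0 i]; first exact: sqrtr_ge0.
rewrite (ord1 i0) -sqrtr_sqr ler_sqrt// /sqnorm (bigD1 i)//= lerDl.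
by apply: sumr_ge0 => j _; exact: sqr_ge0.
Qed.

Lemma sqnorm_le n (w : 'rV[R]_n) : sqnorm w <= n%:R * `|w| ^+ 2.
Proof.
rewrite -[n in n%:R]card_ord mulr_natl -sumr_const; apply: ler_sum => i _.
by rewrite -real_normK ?num_real// ler_sqr ?nnegrE ?mx_norm_coord.
Qed.

Lemma is_derive_sqnorm n (w : R -> 'rV[R]_n) (t : R) dw :
  is_derive t 1 w dw ->
  is_derive t 1 (fun s => sqnorm (w s)) (\sum_i 2 * (w t 0 i * dw 0 i)).
Proof.
move=> dwt; rewrite /sqnorm.
have -> : (fun s => \sum_i w s 0 i ^+ 2) = \sum_i (fun s => w s 0 i ^+ 2).
  by apply/funext => s; rewrite fct_sumE.
apply: is_derive_sum => i.
have di := is_derive_mx_coord dwt 0 i.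
have -> : (fun s => w s 0 i ^+ 2) = (fun s => w s 0 i) * (fun s => w s 0 i).
  by apply/funext => s; rewrite expr2.
by apply: (is_derive_eq (is_deriveM di di)); rewrite /GRing.scale/=; ring.
Qed.

(** The energy [sqnorm (w t) + e ^+ 2] grows at rate at most [c]: with [a] the norm of [w t], twice
    [a * (L * a + e)] is at most [(2 * L + 1) * a ^+ 2 + e ^+ 2], and the sum over coordinates
    contributes [n]. *)
Lemma gronwall n (w w' : R -> 'rV[R]_n) (L e T : R) :
  0 <= L -> 0 <= e -> 0 <= T ->
  (forall t, 0 <= t <= T ->
    is_derive t 1 w (w' t) /\ `|w' t| <= L * `|w t| + e) ->
  `|w T| <= n.+1%:R * expR (n%:R * (2 * L + 1) * T) * (`|w 0| + e).
Proof.
move=> L0 e0 T0 dw; set c := n%:R * (2 * L + 1).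
have n0 : 0 <= n%:R :> R by [].
have c0 : n%:R <= c by rewrite /c; nra.
pose h t := (sqnorm (w t) + e ^+ 2) * expR (- (c * t)).
have dh (t : R) : 0 <= t <= T ->
    is_derive t 1 h (((\sum_i 2 * (w t 0 i * w' t 0 i)) -
      c * (sqnorm (w t) + e ^+ 2)) * expR (- (c * t))).
  move=> /dw[dwt _]; rewrite /h.
  have d1 := is_deriveD (is_derive_sqnorm dwt) (is_derive_cst (e ^+ 2) t (1 : R)).
  have d2 : is_derive t 1 (fun s => expR (- (c * s))) (- c * expR (- (c * t))).
    have d3 : is_derive t 1 (fun s : R => - (c * s)) (- c).
      apply: (is_derive_eq (is_deriveN (is_deriveZ c (is_derive_id t (1 : R))))).
      by rewrite /GRing.scale/= mulr1.
    by apply: is_derive_eq; ring.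
  apply: (is_derive_eq (is_deriveM d1 d2)).
  by rewrite /GRing.scale/= addrfctE /cst; ring.
have hT : h T <= h 0.
  apply: derive_le0_le T0 _ => t tT; split; first exact: dh.
  rewrite mulr_le0_ge0 ?expR_ge0// subr_le0.
  have [_ wt] := dw _ tT.
  have w0 := normr_ge0 (w t); set a := `|w t| in wt w0 *.
  have : \sum_i 2 * (w t 0 i * w' t 0 i) <= n%:R * (2 * (a * (L * a + e))).
    have -> : n%:R * (2 * (a * (L * a + e))) = \sum_(i < n) 2 * (a * (L * a + e)).
      by rewrite sumr_const card_ord [LHS]mulr_natl.
    apply: ler_sum => i _; rewrite ler_wpM2l// (le_trans (ler_norm _))// normrM.
    by rewrite ler_pM ?mx_norm_coord// (le_trans (mx_norm_coord _ _ _)).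
  move=> /le_trans; apply.
  have := sqnorm_ge (w t); rewrite -/a => sa.
  rewrite (@le_trans _ _ (c * (a ^+ 2 + e ^+ 2)))//; last first.
    by rewrite ler_wpM2l ?lerD2r// (le_trans n0 c0).
  rewrite /c -mulrA ler_wpM2l//.
  have := sqr_ge0 (a - e); rewrite !expr2; nra.
have wT : sqnorm (w T) + e ^+ 2 <= expR (c * T) * (sqnorm (w 0) + e ^+ 2).
  move: hT; rewrite /h mulr0 oppr0 expR0 mulr1 expRN.
  by rewrite -ler_pdivlMr ?invr_gt0 ?expR_gt0// invrK mulrC.
have E1 : 1 <= expR (c * T).
  by rewrite -expR0 ler_expR mulr_ge0// (le_trans n0 c0).
set E := expR (c * T) in wT E1 *.
(* After squaring, a factor [n.+1%:R * E] has to be bounded by its own square, which holds since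
   both factors are at least 1. *)
rewrite -ler_sqr ?nnegrE//; last by rewrite !mulr_ge0// ?addr_ge0//; lra.
rewrite (le_trans (sqnorm_ge _))//.
rewrite (@le_trans _ _ (E * (sqnorm (w 0) + e ^+ 2)))//.
  by rewrite (le_trans _ wT)// lerDl sqr_ge0.
have sw := sqnorm_le (w 0).
rewrite (@le_trans _ _ (E * (n%:R * `|w 0| ^+ 2 + e ^+ 2)))//.
  by rewrite ler_wpM2l ?lerD2r//; lra.
have a0 := normr_ge0 (w 0); set a := `|w 0| in a0 *.
have N1 : 1 <= n.+1%:R :> R by rewrite ler1n.
have nN : n%:R <= n.+1%:R :> R by rewrite ler_nat.
set N := n.+1%:R in N1 nN *.
rewrite (@le_trans _ _ (E * (N * (a + e) ^+ 2)))//.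
  rewrite ler_wpM2l//; first lra.
  rewrite (@le_trans _ _ (N * a ^+ 2 + N * e ^+ 2))//.
    by rewrite lerD// ?ler_wpM2r ?sqr_ge0// ler_peMl// sqr_ge0.
  by rewrite -mulrDr ler_wpM2l// !expr2; nra.
rewrite mulrA exprMn ler_wpM2r ?sqr_ge0// (mulrC E) expr2 ler_peMl//.
  by rewrite mulr_ge0//; lra.
by rewrite (le_trans N1)// ler_peMr//; lra.
Qed.

End Gronwall.

(** * Comparison of integral curves on a compact set *)

Section FlowEstimates.
Variables (R : realType) (n : nat).
Implicit Types (M : set 'rV[R]_n) (xi : 'rV[R]_n -> 'rV[R]_n).

(** [A] stands for the differential of [xi] at [a]. The expansion holds for every [b] of [M],
    however far, so that no chart or extension has to be followed along orbits. *)
Definition quadratic_at M xi (C : R) (a : 'rV[R]_n) : Prop :=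
  exists2 A : 'M[R]_n, `|A| <= C &
    forall b, M b -> `|xi b - xi a - (b - a) *m A| <= C * `|b - a| ^+ 2.

Definition integral_curve M xi (T : R) (g : R -> 'rV[R]_n) : Prop :=
  forall t, 0 <= t <= T -> M (g t) /\ is_derive t 1 g (xi (g t)).

Lemma compact_uniform (T : topologicalType) (M : set T) (P : R -> T -> Prop) :
  compact M ->
  (forall x, M x -> exists C, \forall y \near x, M y -> P C y) ->
  (forall C C' y, C <= C' -> P C y -> P C' y) ->
  exists2 C, 0 <= C & forall y, M y -> P C y.
Proof.
move=> /compact_near_coveringP cM loc mono.
have FF : Filter (pinfty_nbhs R) by exact: _.
have [x Mx|C0 [_ CP]] := cM R (pinfty_nbhs R) (fun C y => M y -> P C y) FF.
  have [C CP] := loc x Mx.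
  exists ([set y | M y -> P C y], [set C' | C <= C']) => /=.
    by split => //; exists C; split; [exact: num_real|move=> ? /ltW].
  by move=> [y C'] /= [h CC'] /h; exact: mono.
exists (Num.max 0 (C0 + 1)); first by rewrite le_max lexx.
move=> y My; apply: (mono (C0 + 1)); first by rewrite le_max lexx orbT.
by apply: CP => //; rewrite ltrDl.
Qed.

(** Near a point this is the Taylor estimate. For points at distance at least [e] the left-hand side
    is bounded by an affine function of the distance, which a large constant absorbs; this is why a
    bound [S] on [xi] comes first. *)
Lemma compact_quadratic M xi : compact M -> regular_on (@C2 R) M xi ->
  exists2 C : R, 0 <= C &
    forall a, M a -> `|a| <= C /\ quadratic_at M xi C a.
Proof.
move=> cM rxi.
have jets x (Mx : M x) := regular_jet rxi Mx.
have [S S0 SM] : exists2 S : R, 0 <= S & forall a, M a -> `|a| <= S /\ `|xi a| <= S.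
  apply: compact_uniform => // [x Mx|C C' y CC' [h1 h2]]; last first.
    by rewrite !(le_trans _ CC').
  have [d [K [J [d0 K0 _ taylor _]]]] := jets x Mx.
  have r0 := normr_ge0 x; have r1 := normr_ge0 (xi x).
  exists (`|x| + d + (`|xi x| + K * d ^+ 2 + n%:R * (d * `|J x|))).
  have := nbhsx_ballx x d d0; apply: filterS => y xy My.
  have /ltW yx : `|y - x| < d by move: xy; rewrite -ball_normE/= distrC.
  have j0 : 0 <= n%:R * (d * `|J x|) by rewrite !mulr_ge0// ltW.
  have k0 : 0 <= K * d ^+ 2 by rewrite mulr_ge0// sqr_ge0.
  split.
    have : `|y| <= `|x| + `|y - x| by rewrite -{1}(subrKC x y) ler_normD.
    by lra.
  have := taylor x y (ballxx x d0) xy Mx My => t1.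
  have t2 := mx_norm_mul (y - x) (J x).
  have t3 : n%:R * (`|y - x| * `|J x|) <= n%:R * (d * `|J x|).
    by rewrite ler_wpM2l// ler_wpM2r.
  have t4 : K * `|y - x| ^+ 2 <= K * d ^+ 2.
    by rewrite ler_wpM2l// ler_sqr ?nnegrE ?(ltW d0).
  have : `|xi y| <= `|xi y - xi x - (y - x) *m J x| + `|xi x| + `|(y - x) *m J x|.
    rewrite -[in leLHS](_ : xi y - xi x - (y - x) *m J x + xi x + (y - x) *m J x = xi y).
      by rewrite (le_trans (ler_normD _ _))// lerD2r ler_normD.
    by rewrite addrAC subrK subrK.
  by lra.
have [C C0 CM] : exists2 C : R, 0 <= C & forall a, M a -> quadratic_at M xi C a.
  apply: compact_uniform => // [x Mx|C C' y CC' [A AC Ab]]; last first.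
    exists A => [|b Mb]; first exact: le_trans CC'.
    by rewrite (le_trans (Ab b Mb))// ler_wpM2r// sqr_ge0.
  have [d [K [J [d0 K0 JK taylor _]]]] := jets x Mx.
  pose L := `|J x| + K * d.
  have L0 : 0 <= L by rewrite addr_ge0// mulr_ge0// ltW.
  (* Half the radius, so that [y] and any [b] within [e] of [y] lie in the ball of the jet. In [Q]
     the first term absorbs the values of [xi], the second the linear term. *)
  pose e := d / 2; have e0 : 0 < e by rewrite divr_gt0.
  pose Q := (2 * S) / e ^+ 2 + n%:R * L / e.
  have Q0 : 0 <= Q.
    by rewrite addr_ge0// divr_ge0 ?mulr_ge0// ?sqr_ge0// ltW.
  exists (K + L + Q).
  have := nbhsx_ballx x e e0; apply: filterS => y xy My.
  have xyd : ball x d y by apply: le_ball xy; rewrite /e; lra.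
  exists (J y) => [|b Mb].
    have := JK x y (ballxx x d0) xyd => t1.
    have t2 : `|J y| <= `|J x| + `|J y - J x| by rewrite -{1}(subrKC (J x) (J y)) ler_normD.
    have yx : `|y - x| <= d by apply: ltW; move: xyd; rewrite -ball_normE/= distrC.
    have t3 : K * `|y - x| <= K * d by rewrite ler_wpM2l.
    by rewrite /L in L0 *; lra.
  have sq0 : 0 <= `|b - y| ^+ 2 by exact: sqr_ge0.
  have [yb|yb] := ltP `|b - y| e.
    have xb : ball x d b.
      rewrite -ball_normE/=; move: xy; rewrite -ball_normE/= => xy.
      rewrite distrC in yb.
      by rewrite (le_lt_trans (ler_distD y _ _))// [d]splitr ltrD.
    rewrite (le_trans (taylor y b xyd xb My Mb))// ler_wpM2r//; lra.
  have [_ xib] := SM b Mb; have [_ xiy] := SM y My.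
  have JL : `|J y| <= L.
    have := JK x y (ballxx x d0) xyd => t1.
    have t2 : `|J y| <= `|J x| + `|J y - J x| by rewrite -{1}(subrKC (J x) (J y)) ler_normD.
    have yx : `|y - x| <= d by apply: ltW; move: xyd; rewrite -ball_normE/= distrC.
    have t3 : K * `|y - x| <= K * d by rewrite ler_wpM2l.
    by rewrite /L; lra.
  have t1 : `|xi b - xi y - (b - y) *m J y| <= 2 * S + n%:R * (`|b - y| * L).
    rewrite (le_trans (ler_normB _ _))// lerD//.
      by rewrite (le_trans (ler_normB _ _))//; lra.
    by rewrite (le_trans (mx_norm_mul _ _))// ler_wpM2l// ler_wpM2l.
  rewrite (le_trans t1)// (@le_trans _ _ (Q * `|b - y| ^+ 2))//; last first.
    by rewrite ler_wpM2r//; lra.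
  rewrite /Q [leRHS]mulrDl; apply: lerD.
    rewrite mulrAC ler_pdivlMr ?exprn_gt0// ler_wpM2l//; first lra.
    by rewrite ler_sqr ?nnegrE ?(ltW e0).
  have -> : n%:R * (`|b - y| * L) = n%:R * L / e * (`|b - y| * e).
    by field; rewrite gt_eqF.
  have q0 : 0 <= n%:R * L / e by apply: divr_ge0 (ltW e0); rewrite mulr_ge0.
  by apply: ler_wpM2l q0 _ _ _; rewrite expr2 ler_wpM2l.
exists (S + C) => [|a Ma]; first exact: addr_ge0.
split; first by have [+ _] := SM a Ma; lra.
have [A AC Ab] := CM a Ma; exists A => [|b Mb]; first lra.
by rewrite (le_trans (Ab b Mb))// ler_wpM2r// ?sqr_ge0//; lra.
Qed.

Variables (M : set 'rV[R]_n) (xi : 'rV[R]_n -> 'rV[R]_n) (C : R).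
Hypothesis C0 : 0 <= C.
Hypothesis MC : forall a, M a -> `|a| <= C /\ quadratic_at M xi C a.

(** The quadratic term becomes linear because distances in [M] are at most [2 * C]. *)
Lemma vector_field_lipschitz a b : M a -> M b ->
  `|xi b - xi a| <= (n%:R * C + 2 * C ^+ 2) * `|b - a|.
Proof.
move=> Ma Mb; have [aC [A AC /(_ b Mb) q]] := MC Ma; have [bC _] := MC Mb.
have t1 : `|(b - a) *m A| <= n%:R * (`|b - a| * C).
  by rewrite (le_trans (mx_norm_mul _ _))// ler_wpM2l// ler_wpM2l.
have t2 : `|b - a| <= 2 * C by rewrite (le_trans (ler_normB _ _))//; lra.
have t3 : C * `|b - a| ^+ 2 <= C * (2 * C) * `|b - a|.
  by rewrite expr2 -mulrA ler_wpM2l// ler_wpM2r.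
have : `|xi b - xi a| <= `|xi b - xi a - (b - a) *m A| + `|(b - a) *m A|.
  by rewrite -{1}(subrK ((b - a) *m A) (xi b - xi a)) ler_normD.
by rewrite expr2; lra.
Qed.

Lemma integral_curve_lipschitz (T : R) : exists2 G : R, 0 <= G &
  forall a b, integral_curve M xi T a -> integral_curve M xi T b ->
    forall t, 0 <= t <= T -> `|b t - a t| <= G * `|b 0 - a 0|.
Proof.
pose L := n%:R * C + 2 * C ^+ 2.
have L0 : 0 <= L by rewrite addr_ge0// mulr_ge0// sqr_ge0.
exists (n.+1%:R * expR (n%:R * (2 * L + 1) * T)).
  by rewrite mulr_ge0// expR_ge0.
move=> a b aM bM t /andP[t0 tT].
have := @gronwall R n (fun t => b t - a t) (fun t => xi (b t) - xi (a t)) L 0 t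
  L0 (lexx 0) t0; rewrite addr0 => h.
rewrite (le_trans (h _))//.
  move=> s /andP[s0 st]; have sT : 0 <= s <= T by rewrite s0 (le_trans st).
  have [Ma da] := aM _ sT; have [Mb db] := bM _ sT.
  split; first exact: is_deriveB.
  by rewrite addr0; exact: vector_field_lipschitz.
by rewrite ler_wpM2r// ler_wpM2l// ler_expR ler_wpM2l// mulr_ge0//; lra.
Qed.

(** All expansions are centred on the one orbit [a], so the combination [w] of differences satisfies
    the linear equation with matrix [A] up to weighted quadratic remainders, and Gronwall applies to
    [w] itself. The Lipschitz estimate brings the remainders back to time 0, whence [C * G ^+ 2]. *)
Lemma integral_curve_estimate (T : R) : 0 <= T -> exists2 G : R, 0 <= G &
  forall a b1 b2 b3 (l1 l2 l3 : R), integral_curve M xi T a ->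
    integral_curve M xi T b1 -> integral_curve M xi T b2 ->
    integral_curve M xi T b3 ->
    `|l1 *: (b1 T - a T) + l2 *: (b2 T - a T) + l3 *: (b3 T - a T)| <=
    G * (`|l1 *: (b1 0 - a 0) + l2 *: (b2 0 - a 0) + l3 *: (b3 0 - a 0)| +
         (`|l1| * `|b1 0 - a 0| ^+ 2 + `|l2| * `|b2 0 - a 0| ^+ 2 +
          `|l3| * `|b3 0 - a 0| ^+ 2)).
Proof.
move=> T0; have [G G0 GP] := integral_curve_lipschitz T.
pose L := n%:R * C; have L0 : 0 <= L by rewrite mulr_ge0.
pose E := n.+1%:R * expR (n%:R * (2 * L + 1) * T).
have E0 : 0 <= E by rewrite mulr_ge0// expR_ge0.
have CG : 0 <= C * G ^+ 2 by rewrite mulr_ge0// sqr_ge0.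
exists (E * (1 + C * G ^+ 2)); first by rewrite mulr_ge0//; lra.
move=> a b1 b2 b3 l1 l2 l3 aM bM1 bM2 bM3.
set e := _ + _ + _ * `|b3 0 - a 0| ^+ 2.
have e0 : 0 <= e by rewrite !addr_ge0// mulr_ge0// sqr_ge0.
pose w t := l1 *: (b1 t - a t) + l2 *: (b2 t - a t) + l3 *: (b3 t - a t).
pose w' t := l1 *: (xi (b1 t) - xi (a t)) + l2 *: (xi (b2 t) - xi (a t)) +
  l3 *: (xi (b3 t) - xi (a t)).
have := @gronwall R n w w' L (C * G ^+ 2 * e) T L0.
rewrite mulr_ge0// => /(_ isT T0) h.
rewrite (le_trans (h _))//; last first.
  rewrite -/E -[leRHS]mulrA; apply: ler_wpM2l => //; rewrite -/(w 0).
  by have := mulr_ge0 CG (normr_ge0 (w 0)); lra.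
move=> t tT; have [Ma da] := aM _ tT.
have [Mb1 db1] := bM1 _ tT; have [Mb2 db2] := bM2 _ tT; have [Mb3 db3] := bM3 _ tT.
split.
  exact: is_deriveD.
have [_ [A AC Aq]] := MC Ma.
have wE : w' t = w t *m A +
    (l1 *: (xi (b1 t) - xi (a t) - (b1 t - a t) *m A) +
     l2 *: (xi (b2 t) - xi (a t) - (b2 t - a t) *m A) +
     l3 *: (xi (b3 t) - xi (a t) - (b3 t - a t) *m A)).
  rewrite /w' /w; set x1 := b1 t - a t; set x2 := b2 t - a t; set x3 := b3 t - a t.
  clearbody x1 x2 x3; rewrite !mulmxDl -!scalemxAl.
  set u1 := _ *m A; set u2 := _ *m A; set u3 := _ *m A; clearbody u1 u2 u3.
  by apply/matrixP => i j; rewrite !mxE; ring.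
rewrite wE (le_trans (ler_normD _ _))// lerD//.
  rewrite (le_trans (mx_norm_mul _ _))// /L -mulrA ler_wpM2l// mulrC.
  by rewrite ler_wpM2r.
have q b l : M (b t) -> integral_curve M xi T b ->
    `|l *: (xi (b t) - xi (a t) - (b t - a t) *m A)| <=
    C * G ^+ 2 * (`|l| * `|b 0 - a 0| ^+ 2).
  move=> Mb bM; rewrite normrZ mulrCA ler_wpM2l// (le_trans (Aq _ Mb))//.
  rewrite -mulrA ler_wpM2l// -exprMn ler_sqr ?nnegrE ?mulr_ge0//.
  exact: GP.
rewrite (le_trans (ler_normD _ _))// /e mulrDr lerD ?q//.
by rewrite (le_trans (ler_normD _ _))// mulrDr lerD ?q.
Qed.

End FlowEstimates.

(** * Maps with a uniform first order expansion act on C^1 curves *)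

Section QuadraticMaps.
Variables (R : realType) (n : nat).
Implicit Types (c f : R -> 'rV[R]_n) (M : set 'rV[R]_n).

Definition diff_quot f (t h : R) : 'rV[R]_n := h^-1 *: (f (t + h) - f t).

Lemma diff_quotE f t :
  (fun h : R => h^-1 *: ((f \o shift t) (h *: (1 : R)) - f t)) = diff_quot f t.
Proof.
by apply/funext => h; rewrite /diff_quot /= [_ *: 1]mulr1 (addrC t).
Qed.

Lemma derivable_diff_quotP f t :
  derivable f t 1 <-> cvg (diff_quot f t @ 0^').
Proof. by rewrite /derivable diff_quotE. Qed.

Lemma is_derive_diff_quot f (t : R) v :
  is_derive t 1 f v -> diff_quot f t h @[h --> 0^'] --> v.
Proof.
by case=> df <-; rewrite /derive diff_quotE; apply/derivable_diff_quotP.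
Qed.

(** The mean value theorem in each coordinate, with ['D_1 c] within [eps] of its value at [t0]. Both
    endpoints move, which gives estimates uniform in the base point. *)
Lemma C1_curve_strict c (e t0 : R) :
  (forall t : R, `|t| < e -> derivable c t 1) -> `|t0| < e ->
  {for t0, continuous ('D_1 c)} ->
  forall eps, 0 < eps -> exists2 d, 0 < d & forall s t : R,
    `|s - t0| < d -> `|t - t0| < d ->
    `|c s - c t - (s - t) *: 'D_1 c t0| <= eps * `|s - t|.
Proof.
move=> dc t0e cD eps eps0.
have : \forall r \near t0, `|'D_1 c t0 - 'D_1 c r| <= eps /\ `|r| < e.
  have /cvgrPdist_le h : 'D_1 c r @[r --> t0] --> 'D_1 c t0 by exact: cD.
  by near=> r; split; near: r; [exact: h|exact: near_norm_lt].
move=> /nbhs_ballP[d /= d0 td]; exists d => //.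
have {}td (r : R) : `|r - t0| < d -> `|'D_1 c t0 - 'D_1 c r| <= eps /\ `|r| < e.
  by move=> rd; apply: td; rewrite -ball_normE/= distrC.
have main (s t : R) : s <= t -> `|s - t0| < d -> `|t - t0| < d ->
    `|c t - c s - (t - s) *: 'D_1 c t0| <= eps * `|t - s|.
  move=> st sd tdd; apply: mx_norm_le => [|i0 i]; first by rewrite mulr_ge0// ltW.
  rewrite (ord1 i0).
  have sub (r : R) : s <= r <= t -> `|r - t0| < d.
    move=> /andP[sr rt]; move: sd tdd; rewrite !ltr_norml.
    by move=> /andP[? ?] /andP[? ?]; apply/andP; split; lra.
  have dr (r : R) : s <= r <= t -> is_derive r 1 (fun x => c x 0 i) ('D_1 c r 0 i).
    move=> /sub /td[_ /dc dcr].
    exact: is_derive_mx_coord (derivableP dcr) 0 i.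
  have [r||r rst E] := @MVT_segment R (fun x => c x 0 i) (fun r => 'D_1 c r 0 i) s t st.
  - by rewrite in_itv/= => /andP[? ?]; apply: dr; rewrite !ltW.
  - apply: derivable_within_continuous => r; rewrite in_itv/= => /dr ?.
    exact: ex_derive.
  have -> : (c t - c s - (t - s) *: 'D_1 c t0) 0 i =
      ('D_1 c r 0 i - 'D_1 c t0 0 i) * (t - s).
    by move: E; rewrite !mxE => ->; ring.
  rewrite normrM ler_wpM2r//.
  move: rst; rewrite in_itv/= => /sub /td[h _].
  rewrite distrC; apply: le_trans h.
  have := mx_norm_coord ('D_1 c t0 - 'D_1 c r) 0 i.
  by rewrite mx_subE.
move=> s t sd tdd; have [st|/ltW ts] := leP s t; last exact: main.
have := main s t st sd tdd.
rewrite -normrN (distrC s t); congr (_ <= _); congr `| _ |.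
by apply/matrixP => i j; rewrite !mxE; ring.
Unshelve. all: by end_near. Qed.

(* With weights 1/h, -1/k, 0 this compares two difference quotients of a curve,
   with weights 1/h, -1/h, -1/h it tests the additivity of velocities. *)
Definition quadratic_map M (phi : 'rV[R]_n -> 'rV[R]_n) (G : R) : Prop :=
  forall a b1 b2 b3 (l1 l2 l3 : R), M a -> M b1 -> M b2 -> M b3 ->
    `|l1 *: (phi b1 - phi a) + l2 *: (phi b2 - phi a) + l3 *: (phi b3 - phi a)| <=
    G * (`|l1 *: (b1 - a) + l2 *: (b2 - a) + l3 *: (b3 - a)| +
         (`|l1| * `|b1 - a| ^+ 2 + `|l2| * `|b2 - a| ^+ 2 +
          `|l3| * `|b3 - a| ^+ 2)).

Variables (M : set 'rV[R]_n) (phi : 'rV[R]_n -> 'rV[R]_n) (G : R).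
Hypothesis G0 : 0 <= G.
Hypothesis phiG : quadratic_map M phi G.

(** Uniformity in the base point [t] is the purpose: [t = t0] yields differentiability by
    completeness, and one step [h] for all [t] near [t0] yields continuity of the derivative. *)
Lemma quadratic_map_diff_quot_cauchy c (e t0 : R) :
  (forall t : R, `|t| < e -> derivable c t 1) -> `|t0| < e ->
  (forall t : R, `|t| < e -> M (c t)) ->
  {for t0, continuous ('D_1 c)} ->
  forall eta, 0 < eta -> exists2 d, 0 < d & forall t h k : R,
    `|t - t0| < d -> h != 0 -> k != 0 -> `|h| < d -> `|k| < d ->
    `|diff_quot (phi \o c) t h - diff_quot (phi \o c) t k| <= eta.
Proof.
move=> dc t0e Mc cD eta eta0; set v := 'D_1 c t0.
have v0 : 0 <= `|v| by [].
pose B := `|v| + 1; have B0 : 0 < B by rewrite /B; lra.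
(* Four contributions of at most [r]: the deviations of two quotients of [c] from [v], and two
   quadratic terms, each at most [d * B ^+ 2]. *)
pose r := eta / (4 * (G + 1)).
have G0' := G0.
have r0 : 0 < r by rewrite divr_gt0//; lra.
pose eps := Num.min 1 r.
have eps0 : 0 < eps by rewrite lt_min ltr01.
have [d1 d10 strict] := C1_curve_strict dc t0e cD eps0.
have et0 : 0 < e - `|t0| by rewrite subr_gt0.
pose d := Num.min (Num.min (d1 / 2) ((e - `|t0|) / 2)) (r / B ^+ 2).
have B20 : 0 < B ^+ 2 by rewrite exprn_gt0.
have d0 : 0 < d by rewrite !lt_min (divr_gt0 d10)// (divr_gt0 et0)// (divr_gt0 r0).
exists d => // t h k td h0 k0 hd kd.
have dd1 : d <= d1 / 2 by rewrite !ge_min lexx.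
have dde : d <= (e - `|t0|) / 2 by rewrite !ge_min lexx orbT.
have ddr : d <= r / B ^+ 2 by rewrite !ge_min lexx orbT.
have tE : `|t| <= `|t0| + `|t - t0| by rewrite -{1}(subrKC t0 t) ler_normD.
have Mt : M (c t) by apply: Mc; lra.
have quot (l : R) : l != 0 -> `|l| < d ->
    [/\ M (c (t + l)), `|l^-1 *: (c (t + l) - c t) - v| <= eps &
        `|l^-1| * `|c (t + l) - c t| ^+ 2 <= d * B ^+ 2].
  move=> l0 ld; have lE := ler_normD t l.
  have l1 : `|t + l - t0| < d1.
    by have := ler_normD (t - t0) l; rewrite addrAC; lra.
  have := strict (t + l) t l1; rewrite (_ : t + l - t = l) -/v; last by ring.
  move=> st.
  have {}st : `|c (t + l) - c t - l *: v| <= eps * `|l| by apply: st; lra.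
  have nl : 0 < `|l| by rewrite normr_gt0.
  have q1 : `|l^-1 *: (c (t + l) - c t) - v| <= eps.
    have -> : l^-1 *: (c (t + l) - c t) - v = l^-1 *: (c (t + l) - c t - l *: v).
      by rewrite [RHS]scalerBr scalerA mulVf// scale1r.
    by rewrite normrZ normfV mulrC ler_pdivrMr.
  split=> //; first by apply: Mc; lra.
  have q2 : `|l^-1 *: (c (t + l) - c t)| <= B.
    have := ler_normD (l^-1 *: (c (t + l) - c t) - v) v.
    have : eps <= 1 by rewrite /eps ge_min lexx.
    by rewrite subrK /B; lra.
  have -> : `|l^-1| * `|c (t + l) - c t| ^+ 2 =
      `|l| * `|l^-1 *: (c (t + l) - c t)| ^+ 2.
    rewrite normrZ normfV; field; lra.
  rewrite ler_pM ?sqr_ge0//; first lra.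
  by rewrite ler_sqr ?nnegrE ?(ltW B0).
have [Mh qh1 qh2] := quot _ h0 hd; have [Mk qk1 qk2] := quot _ k0 kd.
have := @phiG (c t) (c (t + h)) (c (t + k)) (c t) h^-1 (- k^-1) 0 Mt Mh Mk Mt.
rewrite !subrr !scale0r !addr0 normr0 mul0r addr0 !scaleNr normrN => main.
rewrite (le_trans main)//.
have qhk : `|h^-1 *: (c (t + h) - c t) - k^-1 *: (c (t + k) - c t)| <= 2 * eps.
  have := ler_normB (h^-1 *: (c (t + h) - c t) - v) (k^-1 *: (c (t + k) - c t) - v).
  by rewrite opprB addrA subrK; lra.
have er : eps <= r by rewrite /eps ge_min lexx orbT.
have dB : d * B ^+ 2 <= r by rewrite -ler_pdivlMr// exprn_gt0.
rewrite (@le_trans _ _ (G * (4 * r)))//; first by rewrite ler_wpM2l//; lra.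
rewrite /r (_ : 4 * (eta / (4 * (G + 1))) = eta / (G + 1)); last by field; lra.
by rewrite mulrA ler_pdivrMr; [nra|lra].
Qed.

End QuadraticMaps.

Section QuadraticMapCurves.
Variables (R : realType) (n : nat).
Variables (M : set 'rV[R]_n) (phi : 'rV[R]_n -> 'rV[R]_n) (G : R).
Hypothesis G0 : 0 <= G.
Hypothesis phiG : quadratic_map M phi G.

(** No candidate for the derivative of [phi \o c] is at hand: it exists by the Cauchy criterion, and
    it is continuous by comparison with difference quotients of a fixed step. *)
Lemma quadratic_map_curve (X Y : set 'rV[R]_n) x v c :
  X `<=` M -> (forall z, X z -> Y (phi z)) -> curve_in X x v c ->
  exists v', curve_in Y (phi x) v' (phi \o c).
Proof.
move=> XM XY /curve_inP[e e0 [dc D1c Xc c0 dc0]].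
have Mc (t : R) : `|t| < e -> M (c t) by move=> /Xc /XM.
pose UC (t0 : R) (t0e : `|t0| < e) :=
  quadratic_map_diff_quot_cauchy G0 phiG dc t0e Mc (D1c _ t0e).
have near0 (d : R) : 0 < d -> \forall h \near (0 : R)^', h != 0 /\ `|h| < d.
  move=> d0; near=> h; split; near: h; first exact: nbhs_dnbhs_neq.
  by exact: dnbhs0_lt.
have dphi (t0 : R) : `|t0| < e -> derivable (phi \o c) t0 1.
  move=> t0e; apply/derivable_diff_quotP.
  apply/cauchy_cvgP/cauchy_exP => eta eta0.
  have eta2 : 0 < eta / 2 by rewrite divr_gt0.
  have [d d0 dP] := UC t0 t0e _ eta2.
  exists (diff_quot (phi \o c) t0 (d / 2)).
  suff : \forall h \near 0^', ball (diff_quot (phi \o c) t0 (d / 2)) eta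
    (diff_quot (phi \o c) t0 h) by [].
  apply: filterS (near0 d d0) => h /= [h0 hd].
  rewrite -ball_normE/= (@le_lt_trans _ _ (eta / 2))//; last by lra.
  have d2 : `|d / 2| < d by rewrite ger0_norm ?divr_ge0//; lra.
  apply: dP => //; first by rewrite subrr normr0.
  by rewrite gt_eqF// divr_gt0.
exists ('D_1 (phi \o c) 0); apply/curve_inP; exists e; [exact: e0|split].
- exact: dphi.
- move=> t0 t0e; apply/cvgrPdist_le => eta eta0.
  (* Two fifths for derivative against quotient at each of [t] and [t0], one fifth for the
     continuity of the quotient in [t]. *)
  have eta5 : 0 < eta / 5 by rewrite divr_gt0.
  have [d d0 dP] := UC t0 t0e _ eta5.
  have et0 : 0 < e - `|t0| by rewrite subr_gt0.
  pose h := Num.min (d / 2) ((e - `|t0|) / 2).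
  have h0 : 0 < h by rewrite lt_min !divr_gt0.
  have hd : `|h| < d.
    by rewrite gtr0_norm// (@le_lt_trans _ _ (d / 2)) ?ge_min ?lexx//; lra.
  have th : `|t0 + h| < e.
    have := ler_normD t0 h; rewrite (gtr0_norm h0).
    have : h <= (e - `|t0|) / 2 by rewrite ge_min lexx orbT.
    by lra.
  have diffq (t : R) : `|t| < e -> `|t - t0| < d ->
      `|'D_1 (phi \o c) t - diff_quot (phi \o c) t h| <= 2 * (eta / 5).
    move=> te td.
    have /cvgrPdist_le/(_ _ eta5) cq := is_derive_diff_quot (derivableP (dphi t te)).
    have cqd := filterI cq (near0 _ d0).
    have [k [/= cqk [k0 kd]]] := @filter_ex _ ((0 : R)^') _ _ (cqd _).
    have := dP t k h td k0 (lt0r_neq0 h0) kd hd.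
    have := ler_distD (diff_quot (phi \o c) t k)
      ('D_1 (phi \o c) t) (diff_quot (phi \o c) t h).
    by move: cqk => /=; lra.
  have cont (s : R) : `|s| < e -> (phi \o c) r @[r --> s] --> (phi \o c) s.
    move=> se; apply: differentiable_continuous.
    exact/derivable1_diffP/dphi.
  have qc : diff_quot (phi \o c) t h @[t --> t0] --> diff_quot (phi \o c) t0 h.
    apply: cvgZl_tmp; apply: cvgB; last exact: cont.
    have := cont _ th => ch; apply: cvg_comp ch.
    by apply: cvgD; [exact: cvg_id|exact: cvg_cst].
  move/cvgrPdist_le : qc => /(_ _ eta5) qc.
  have tnear : \forall t \near t0, `|t - t0| < d.
    by have := nbhsx_ballx t0 d d0; apply: filterS => t; rewrite -ball_normE/= distrC.
  near=> t.
  have te : `|t| < e by near: t; exact: near_norm_lt.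
  have td : `|t - t0| < d by near: t.
  have t0d : `|t0 - t0| < d by rewrite subrr normr0.
  have := diffq t te td; have := diffq t0 t0e t0d.
  have : `|diff_quot (phi \o c) t0 h - diff_quot (phi \o c) t h| <= eta / 5 by near: t.
  have := ler_distD (diff_quot (phi \o c) t0 h) ('D_1 (phi \o c) t0) ('D_1 (phi \o c) t).
  have := ler_distD (diff_quot (phi \o c) t h) (diff_quot (phi \o c) t0 h) ('D_1 (phi \o c) t).
  rewrite (distrC (diff_quot (phi \o c) t h) ('D_1 (phi \o c) t)).
  by lra.
- by move=> t /Xc /XY.
- by rewrite /= c0.
- by apply: derivableP; apply: dphi; rewrite normr0.
Unshelve. all: by end_near. Qed.

Lemma quadratic_map_linear x v1 v2 v3 w1 w2 w3 c1 c2 c3 :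
  curve_in M x v1 c1 -> curve_in M x v2 c2 -> curve_in M x v3 c3 ->
  is_derive (0 : R) 1 (phi \o c1) w1 -> is_derive (0 : R) 1 (phi \o c2) w2 ->
  is_derive (0 : R) 1 (phi \o c3) w3 ->
  v1 = v2 + v3 -> w1 = w2 + w3.
Proof.
move=> cM1 cM2 cM3 dw1 dw2 dw3 v123.
have dc1 := is_derive_diff_quot (curve_in_derive cM1).
have dc2 := is_derive_diff_quot (curve_in_derive cM2).
have dc3 := is_derive_diff_quot (curve_in_derive cM3).
have dp1 := is_derive_diff_quot dw1.
have dp2 := is_derive_diff_quot dw2.
have dp3 := is_derive_diff_quot dw3.
have [/curve_inP[e1 e10 [_ _ M1 c10 _]] /curve_inP[e2 e20 [_ _ M2 c20 _]]
  /curve_inP[e3 e30 [_ _ M3 c30 _]]] := And3 cM1 cM2 cM3.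
pose q (c1 c2 c3 : R -> 'rV[R]_n) h :=
  diff_quot c1 0 h - diff_quot c2 0 h - diff_quot c3 0 h.
(* The majorant given by [quadratic_map], with each [|h^-1| * |c h - x| ^+ 2] rewritten as [|h|]
   times a squared difference quotient, so that it tends to 0. *)
pose b h := `|q c1 c2 c3 h| + (`|h| * `|diff_quot c1 0 h| ^+ 2 +
  `|h| * `|diff_quot c2 0 h| ^+ 2 + `|h| * `|diff_quot c3 0 h| ^+ 2).
have b0 : b h @[h --> 0^'] --> (0 : R).
  have hc (c : R -> 'rV[R]_n) (v : 'rV[R]_n) : diff_quot c 0 h @[h --> 0^'] --> v ->
      `|h| * `|diff_quot c 0 h| ^+ 2 @[h --> 0^'] --> (0 : R).
    move=> cv; rewrite -[X in _ --> X](mul0r (`|v| * `|v|)); apply: cvgM.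
      have h0 : h @[h --> (0 : R)^'] --> (0 : R) by exact: nbhs_dnbhs.
      by have := cvg_norm h0 => /(_ _); rewrite normr0; apply.
    by under eq_cvg do rewrite expr2; apply: cvgM; exact: cvg_norm.
  rewrite -[X in _ --> X]addr0; apply: cvgD.
    have qv : q c1 c2 c3 h @[h --> (0 : R)^'] --> v1 - v2 - v3.
      by apply: cvgB => //; exact: cvgB.
    by have := cvg_norm qv => /(_ _); rewrite v123 -addrA -opprD subrr normr0; apply.
  rewrite -[X in _ --> X]addr0; apply: cvgD; last exact: hc dc3.
  by rewrite -[X in _ --> X]addr0; apply: cvgD; [exact: hc dc1|exact: hc dc2].
have qw : q (phi \o c1) (phi \o c2) (phi \o c3) h @[h --> 0^'] --> w1 - w2 - w3.
  by apply: cvgB => //; exact: cvgB.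
have q0 : q (phi \o c1) (phi \o c2) (phi \o c3) h @[h --> 0^'] --> (0 : 'rV[R]_n).
  apply: (@cvg_of_norm_le _ _ _ _ _ _ _ b G) b0.
  near=> h; rewrite subr0.
  have h0 : h != 0 by near: h; exact: nbhs_dnbhs_neq.
  have h1 : `|h| < e1 by near: h; exact: dnbhs0_lt.
  have h2 : `|h| < e2 by near: h; exact: dnbhs0_lt.
  have h3 : `|h| < e3 by near: h; exact: dnbhs0_lt.
  have Mx : M x by rewrite -c10; apply: M1; rewrite normr0.
  have := @phiG x (c1 h) (c2 h) (c3 h) h^-1 (- h^-1) (- h^-1) Mx (M1 _ h1) (M2 _ h2) (M3 _ h3).
  have E c : c 0 = x -> `|h^-1| * `|c h - x| ^+ 2 = `|h| * `|diff_quot c 0 h| ^+ 2.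
    move=> c0; rewrite /diff_quot add0r c0 normrZ normfV; field.
    by rewrite normr_eq0.
  rewrite normrN !E// !scaleNr.
  by rewrite /b /q /diff_quot !add0r /= c10 c20 c30.
have /eqP : w1 - w2 - w3 = 0 by apply: cvg_unique qw q0; exact: norm_hausdorff.
by rewrite -addrA -opprD subr_eq0 => /eqP.
Unshelve. all: by end_near. Qed.

End QuadraticMapCurves.

(** * Flows of regular vector fields *)

Section RegularFlows.
Variables (R : realType) (n : nat) (M : set 'rV[R]_n).
Implicit Types (xi : 'rV[R]_n -> 'rV[R]_n) (Phi : R -> 'rV[R]_n -> 'rV[R]_n).

Lemma is_derive_affine (V : normedModType R) (g : R -> V) (a b t : R) (v : V) :
  is_derive (a * t + b) 1 g v -> is_derive t 1 (fun s => g (a * s + b)) (a *: v).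
Proof.
move=> dg; have dd : differentiable g (a * t + b).
  by apply/derivable1_diffP; exact: ex_derive.
have dl : is_derive t 1 (fun s : R => a * s + b) a.
  apply: (is_derive_eq (is_deriveD (is_deriveZ a (is_derive_id t (1 : R)))
    (is_derive_cst b t (1 : R)))).
  by rewrite /GRing.scale/= mulr1 addr0.
have := @is_derive_chain R R V g (fun s : R => a * s + b) t a dd dl.
have <- : 'D_1 g (a * t + b) = v by exact: derive_val.
have -> // : 'D_a g (a * t + b) = a *: 'D_1 g (a * t + b).
rewrite (deriveE (a : R^o) dd) (deriveE (1 : R^o) dd) -linearZ/=.
by congr ('d g _ _); rewrite /GRing.scale/= mulr1.
Qed.

(** Only the uniform expansion of the field is retained: it is insensitive to the sign of [xi], so
    statements for positive times pass to negative ones. *)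
Definition regular_flow xi Phi : Prop := is_flow M xi Phi /\
  exists2 C : R, 0 <= C & forall a, M a -> `|a| <= C /\ quadratic_at M xi C a.

Lemma regular_flow_rev xi Phi : regular_flow xi Phi ->
  regular_flow (fun x => - xi x) (fun t => Phi (- t)).
Proof.
move=> [flow [C C0 MC]]; split.
  move=> x Mx; have [x0 xt] := flow x Mx; split; first by rewrite oppr0.
  move=> t; have [Mt dt] := xt (- t); split=> //.
  have := @is_derive_affine _ (Phi ^~ x) (-1) 0 t (xi (Phi (- t) x)).
  rewrite mulN1r addr0 scaleN1r => /(_ dt).
  by congr (is_derive _ _ _ _); apply/funext => s; rewrite mulN1r addr0.
exists C => // a Ma; have [aC [A AC Aq]] := MC a Ma; split=> //.
exists (- A); first by rewrite normrN.
move=> b Mb; rewrite mulmxN -!opprD normrN; exact: Aq.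
Qed.

Variables (xi : 'rV[R]_n -> 'rV[R]_n) (Phi : R -> 'rV[R]_n -> 'rV[R]_n).
Hypothesis flow : regular_flow xi Phi.

Lemma flow_in t x : M x -> M (Phi t x).
Proof. by move=> Mx; have [/(_ x Mx)[_ /(_ t)[]]] := flow. Qed.

Lemma flow0 x : M x -> Phi 0 x = x.
Proof. by move=> Mx; have [/(_ x Mx)[]] := flow. Qed.

Lemma flow_derive (t : R) x : M x -> is_derive t 1 (Phi ^~ x) (xi (Phi t x)).
Proof. by move=> Mx; have [/(_ x Mx)[_ /(_ t)[]]] := flow. Qed.

Lemma flow_integral_curve (T : R) x : M x -> integral_curve M xi T (Phi ^~ x).
Proof. by move=> Mx t _; split; [exact: flow_in|exact: flow_derive]. Qed.

Lemma flow_unique (T : R) g : 0 <= T -> M (g 0) -> integral_curve M xi T g ->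
  g T = Phi T (g 0).
Proof.
move=> T0 Mg gM; have [_ [C C0 MC]] := flow.
have [G G0 lip] := integral_curve_lipschitz C0 MC T.
have := lip _ _ (flow_integral_curve Mg) gM T.
rewrite T0 lexx flow0// subrr normr0 mulr0 => /(_ isT).
by rewrite normr_le0 subr_eq0 => /eqP.
Qed.

Lemma flow_add_ge0 s t x : 0 <= s -> M x -> Phi s (Phi t x) = Phi (s + t) x.
Proof.
move=> s0 Mx; have := @flow_unique s (fun r => Phi (r + t) x) s0.
rewrite add0r => -> //; first exact: flow_in.
move=> r _; split; first exact: flow_in.
have := @is_derive_affine _ (Phi ^~ x) 1 t r (xi (Phi (r + t) x)).
rewrite mul1r scale1r => /(_ (flow_derive (r + t) Mx)).
by congr (is_derive _ _ _ _); apply/funext => q; rewrite mul1r.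
Qed.

Lemma flow_quadratic_ge0 (T : R) : 0 <= T ->
  exists2 G, 0 <= G & quadratic_map M (Phi T) G.
Proof.
move=> T0; have [_ [C C0 MC]] := flow.
have [G G0 est] := integral_curve_estimate C0 MC T0.
exists G => // a b1 b2 b3 l1 l2 l3 Ma Mb1 Mb2 Mb3.
have ic x (Mx : M x) := @flow_integral_curve T x Mx.
have := est _ _ _ _ l1 l2 l3 (ic _ Ma) (ic _ Mb1) (ic _ Mb2) (ic _ Mb3).
by rewrite !flow0.
Qed.

End RegularFlows.

Section RegularFlows2.
Variables (R : realType) (n : nat) (M : set 'rV[R]_n).
Variables (xi : 'rV[R]_n -> 'rV[R]_n) (Phi : R -> 'rV[R]_n -> 'rV[R]_n).
Hypothesis flow : regular_flow M xi Phi.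

Lemma flow_add s t x : M x -> Phi s (Phi t x) = Phi (s + t) x.
Proof.
move=> Mx; have [s0|/ltW s0] := leP 0 s; first exact: (flow_add_ge0 flow).
have := @flow_add_ge0 _ _ _ _ _ (regular_flow_rev flow) (- s) (- t) x.
by rewrite -opprD !opprK oppr_ge0; exact.
Qed.

Lemma flow_quadratic (T : R) : exists2 G, 0 <= G & quadratic_map M (Phi T) G.
Proof.
have [T0|/ltW T0] := leP 0 T; first exact: (flow_quadratic_ge0 flow).
have := @flow_quadratic_ge0 _ _ _ _ _ (regular_flow_rev flow) (- T).
by rewrite opprK oppr_ge0; exact.
Qed.

Lemma flow_curve T (X Y : set 'rV[R]_n) x v c :
  X `<=` M -> (forall z, X z -> Y (Phi T z)) -> curve_in X x v c ->
  exists v', curve_in Y (Phi T x) v' (Phi T \o c).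
Proof.
by have [G G0 PhiG] := flow_quadratic T; exact: quadratic_map_curve G0 PhiG _ _ _ _ _.
Qed.

Lemma flow_curve_linear T x v1 v2 v3 w1 w2 w3 c1 c2 c3 :
  curve_in M x v1 c1 -> curve_in M x v2 c2 -> curve_in M x v3 c3 ->
  is_derive (0 : R) 1 (Phi T \o c1) w1 -> is_derive (0 : R) 1 (Phi T \o c2) w2 ->
  is_derive (0 : R) 1 (Phi T \o c3) w3 ->
  v1 = v2 + v3 -> w1 = w2 + w3.
Proof.
move=> c1M c2M c3M d1 d2 d3; have [G _ PhiG] := flow_quadratic T.
exact: (quadratic_map_linear PhiG c1M c2M c3M d1 d2 d3).
Qed.

Lemma flow_continuous T x (I : Type) (F : set_system I) (FF : Filter F)
    (c : I -> 'rV[R]_n) : M x ->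
  (\forall i \near F, M (c i)) -> c i @[i --> F] --> x ->
  Phi T (c i) @[i --> F] --> Phi T x.
Proof.
move=> Mx Mc cx; have [G G0 PhiG] := flow_quadratic T.
apply: (@cvg_of_norm_le _ _ _ _ _ _ _ (fun i => `|c i - x| + `|c i - x| * `|c i - x|) G).
  apply: filterS Mc => i Mi.
  have := @PhiG x (c i) x x 1 0 0 Mx Mi Mx Mx.
  by rewrite !scale1r !scale0r !addr0 normr1 normr0 !mul0r !addr0 mul1r expr2.
have n0 : `|c i - x| @[i --> F] --> (0 : R) by apply/norm_cvg0P/subr_cvg0.
rewrite -[X in _ --> X]addr0 -[X in _ --> _ + X](mul0r 0).
by apply: cvgD => //; exact: cvgM.
Qed.

End RegularFlows2.

(** * Linearizing charts *)

Section LinearCharts.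
Variable R : realType.

Lemma sqnorm_enorm n (u : 'rV[R]_n) : enorm u = Num.sqrt (sqnorm u).
Proof. by []. Qed.

Lemma sqnorm_ge0 n (u : 'rV[R]_n) : 0 <= sqnorm u.
Proof. by apply: sumr_ge0 => i _; exact: sqr_ge0. Qed.

Lemma unit_ballE m (u : 'rV[R]_m) : unit_ball u <-> sqnorm u < 1.
Proof.
rewrite /unit_ball/= sqnorm_enorm -{1}(sqrtr1 R) ltr_sqrt//.
Qed.

Lemma unit_ball_open m : open (@unit_ball R m).
Proof.
have -> : @unit_ball R m = (@sqnorm R m) @^-1` [set x | x < 1].
  by apply/seteqP; split => u /unit_ballE.
apply: open_comp; last exact: open_lt.
move=> u _.
have -> : @sqnorm R m = \sum_i (fun w : 'rV[R]_m => w 0 i * w 0 i).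
  apply/funext => w; rewrite fct_sumE /sqnorm.
  by apply: eq_bigr => i _; rewrite expr2.
apply: (big_ind (fun f : 'rV[R]_m -> R => {for u, continuous f})).
- exact: cst_continuous.
- by move=> f g cf cg; exact: (@continuousD _ R^o).
- move=> i _; have ci : w 0 i @[w --> u] --> u 0 i.
    exact: (@coord_continuous R 1 m 0 i u).
  exact: (cvgM ci ci).
Qed.

Lemma unit_ball0 m : unit_ball (0 : 'rV[R]_m).
Proof.
apply/unit_ballE; rewrite /sqnorm big1// => i _.
by rewrite mxE expr0n.
Qed.

Lemma unit_ball_dominated m (u v : 'rV[R]_m) :
  (forall i, `|v 0 i| <= `|u 0 i|) -> unit_ball u -> unit_ball v.
Proof.
move=> vu /unit_ballE u1; apply/unit_ballE; apply: le_lt_trans u1.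
apply: ler_sum => i _; rewrite -(real_normK (num_real _)).
rewrite -[leRHS](real_normK (num_real _)).
by rewrite ler_sqr ?nnegrE ?vu.
Qed.

Lemma unit_ball_coord m (u : 'rV[R]_m) i : unit_ball u -> `|u 0 i| <= 1.
Proof.
move=> /unit_ballE/ltW u1.
rewrite (le_trans (mx_norm_coord _ _ _))// -(@ler_sqr _ `|u| 1) ?nnegrE//.
by rewrite expr1n (le_trans (sqnorm_ge _)).
Qed.

Variables (n m : nat) (M : set 'rV[R]_n).
Implicit Types (Phi : R -> 'rV[R]_n -> 'rV[R]_n).

(* The derivative along the orbit is the push-forward of the vector field, so the
   last clause says that this push-forward is diagonal with rates [a]. *)
Definition linear_chart Phi q (W : set 'rV[R]_n) (Psi : 'rV[R]_n -> 'rV[R]_m)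
    (psi : 'rV[R]_m -> 'rV[R]_n) (a : 'I_m -> R) : Prop :=
  [/\ open W /\ W q, diffeo (@C2 R) (M `&` W) (@unit_ball R m) Psi psi,
      M q, Psi q = 0 &
      forall x, M x -> W x ->
        is_derive (0 : R) 1 (fun t => Psi (Phi t x)) (\row_i (a i * Psi x 0 i))].

Lemma linear_chart_rev Phi q W Psi psi a : linear_chart Phi q W Psi psi a ->
  linear_chart (fun t => Phi (- t)) q W Psi psi (fun i => - a i).
Proof.
move=> [oW PP Mq q0 dP]; split=> // x Mx Wx.
have := @is_derive_affine R _ (fun t => Psi (Phi t x)) (-1) 0 0
  (\row_i (a i * Psi x 0 i)).
rewrite mulr0 addr0 => /(_ (dP x Mx Wx)).
have -> : (-1) *: (\row_i (a i * Psi x 0 i)) = \row_i (- a i * Psi x 0 i).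
  by apply/rowP => i; rewrite !mxE; ring.
by congr (is_derive _ _ _ _); apply/funext => s; rewrite mulN1r addr0.
Qed.

Definition lin_flow (a : 'I_m -> R) (t : R) (u : 'rV[R]_m) : 'rV[R]_m :=
  \row_i (expR (a i * t) * u 0 i).

Lemma lin_flow0 a u : lin_flow a 0 u = u.
Proof. by apply/rowP => i; rewrite mxE mulr0 expR0 mul1r. Qed.

Lemma lin_flow_derive a (t : R) u :
  is_derive t 1 (fun s => lin_flow a s u) (\row_i (a i * lin_flow a t u 0 i)).
Proof.
apply: is_derive_mxP => i0 i; rewrite !mxE.
have -> : (fun s => lin_flow a s u i0 i) = (fun s => (expR (a i * s)) * u 0 i).
  by apply/funext => s; rewrite mxE.
have d1 : is_derive t 1 (fun s : R => a i * s) (a i).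
  apply: (is_derive_eq (is_deriveZ (a i) (is_derive_id t (1 : R)))).
  by rewrite /GRing.scale/= mulr1.
have d2 : is_derive t 1 (fun s => expR (a i * s)) (a i * expR (a i * t)).
  by apply: is_derive_eq; ring.
apply: (is_derive_eq (is_deriveM d2 (is_derive_cst (u 0 i) t (1 : R)))).
by rewrite /GRing.scale/= /cst; ring.
Qed.

Variables (xi : 'rV[R]_n -> 'rV[R]_n) (Phi : R -> 'rV[R]_n -> 'rV[R]_n).
Hypothesis flow : regular_flow M xi Phi.
Variables (q : 'rV[R]_n) (W : set 'rV[R]_n) (Psi : 'rV[R]_n -> 'rV[R]_m).
Variables (psi : 'rV[R]_m -> 'rV[R]_n) (a : 'I_m -> R).
Hypothesis lc : linear_chart Phi q W Psi psi a.

Lemma linear_chart_psi0 : psi 0 = q.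
Proof.
have [[oW Wq] [PsiB _ _ _] Mq q0 _] := lc.
by have [_ <-] := PsiB q (conj Mq Wq); rewrite q0.
Qed.

(** [linear_chart] gives the velocity of [Psi] along orbits. Through the jet of [psi], the model
    curve at time [t] and [psi \o Psi] along the orbit of [y] at time 0 have the same velocity; the
    latter curve is the orbit itself near time 0. *)
Lemma linear_chart_integral u (t : R) : unit_ball (lin_flow a t u) ->
  is_derive t 1 (fun s => psi (lin_flow a s u)) (xi (psi (lin_flow a t u))).
Proof.
set z := lin_flow a t u => Bz.
have [[oW Wq] [PsiB psiM rPsi rpsi] Mq q0 dP] := lc.
have [[My Wy] PsiE] := psiM _ Bz; set y := psi z in My Wy PsiE *.
have [d [K [Q [d0 _ _ _ dpsi]]]] := regular_jet rpsi Bz.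
have near_in (k : Type) (c : R -> 'rV[R]_m) (s : R) v : is_derive s 1 c v -> c s = z ->
    \forall r \near s, unit_ball (c r).
  move=> dc cs; have cc : c r @[r --> s] --> c s.
    by apply: differentiable_continuous; apply/derivable1_diffP; exact: ex_derive.
  by apply: cc; rewrite cs; apply: open_nbhs_nbhs; split=> //; exact: unit_ball_open.
have d1 : is_derive t 1 (psi \o (fun s => lin_flow a s u))
    (\row_i (a i * z 0 i) *m Q z).
  apply: dpsi; first exact: ballxx.
    exact: near_in nat _ _ _ (lin_flow_derive a t u) erefl.
  exact: lin_flow_derive.
have y0 : Phi 0 y = y by exact: (flow0 flow).
have d2' := dP y My Wy; rewrite PsiE in d2'.
have d2 : is_derive (0 : R) 1 (psi \o (fun s => Psi (Phi s y)))
    (\row_i (a i * z 0 i) *m Q z).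
  have := dpsi (fun s => Psi (Phi s y)) 0 _ _ _ d2'.
  rewrite y0 PsiE; apply; first exact: ballxx.
  by apply: (near_in nat _ _ _ d2'); rewrite y0 PsiE.
have fd := flow_derive flow 0 My; rewrite y0 in fd.
have d3 : is_derive (0 : R) 1 (psi \o (fun s => Psi (Phi s y))) (xi y).
  apply: (near_eq_is_derive _ fd).
  have cc : Phi s y @[s --> (0 : R)] --> Phi 0 y.
    apply: differentiable_continuous; apply/derivable1_diffP.
    exact: (@ex_derive _ _ _ _ _ _ _ fd).
  have : \forall s \near (0 : R), W (Phi s y).
    by apply: cc; rewrite y0; exact: open_nbhs_nbhs.
  apply: filterS => s Ws /=.
  by have [_ ->] := PsiB (Phi s y) (conj (flow_in flow s My) Ws).
have <- : \row_i (a i * z 0 i) *m Q z = xi y.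
  exact: is_derive_unique d2 d3.
exact: d1.
Qed.

Lemma linear_chart_flow u (T : R) : 0 <= T ->
  (forall t, 0 <= t <= T -> unit_ball (lin_flow a t u)) ->
  Phi T (psi u) = psi (lin_flow a T u).
Proof.
move=> T0 Bu; have [_ [_ psiM _ _] _ _ _] := lc.
have B0 : unit_ball u by rewrite -(lin_flow0 a u); apply: Bu; rewrite lexx.
have := @flow_unique _ _ _ _ _ flow T (fun s => psi (lin_flow a s u)) T0.
rewrite lin_flow0 => -> //; first by have [[]] := psiM u B0.
move=> t /Bu Bt; split; first by have [[]] := psiM _ Bt.
exact: linear_chart_integral.
Qed.

(** When the coordinates of nonnegative rate vanish, the model flow contracts all the others: it
    stays in the ball and tends to 0. *)
Lemma linear_chart_stable u : unit_ball u ->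
  (forall i, 0 <= a i -> u 0 i = 0) -> stable M Phi q (psi u).
Proof.
move=> Bu u0; have [_ [_ psiM _ rpsi] _ _ _] := lc.
split; first by have [[]] := psiM u Bu.
have Bt (t : R) : 0 <= t -> unit_ball (lin_flow a t u).
  move=> t0; apply: unit_ball_dominated Bu => i; rewrite mxE.
  have [/u0 ->|ai] := leP 0 (a i); first by rewrite mulr0.
  by rewrite normrM ler_piMl// ger0_norm ?expR_ge0// -expR0 ler_expR nmulr_rle0.
have cvg0 : lin_flow a t u @[t --> +oo] --> (0 : 'rV[R]_m).
  apply/cvg_mx_coordP => i0 i; rewrite (ord1 i0) mxE.
  have -> : (fun t => lin_flow a t u 0 i) = (fun t => expR (a i * t) * u 0 i).
    by apply/funext => t; rewrite mxE.
  have [/u0 ->|ai] := leP 0 (a i).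
    have -> : (fun t => expR (a i * t) * 0) = cst 0.
      by apply/funext => t; rewrite mulr0.
    exact: cvg_cst.
  rewrite -[X in _ --> X](mul0r (u 0 i)); apply: cvgMr_tmp.
  have ai0 : 0 < - a i by rewrite oppr_gt0.
  have := cvg_comp _ _ (gt0_cvgMry ai0 cvg_id) (@cvgr_expR R).
  rewrite (_ : _ \o _ = fun t => expR (a i * t)); last first.
    by apply/funext => t; rewrite /= mulNr opprK.
  by apply.
have B0 := @unit_ball0 m.
have psiT : psi (lin_flow a t u) @[t --> +oo] --> q.
  rewrite -linear_chart_psi0; apply: regular_cvg rpsi B0 _ cvg0.
  by near=> t; apply: Bt; near: t; exact: nbhs_pinfty_ge.
apply: cvg_trans psiT; apply: near_eq_cvg; near=> T.
have T0 : 0 <= T by near: T; exact: nbhs_pinfty_ge.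
by rewrite linear_chart_flow// => t /andP[t0 _]; exact: Bt.
Unshelve. all: by end_near. Qed.

(** Along the orbit this coordinate is multiplied by [expR (a i * t)], yet it stays bounded by 1
    since the orbit never leaves the chart. *)
Lemma linear_chart_trapped y : M y -> (forall t, 0 <= t -> W (Phi t y)) ->
  forall i, 0 < a i -> Psi y 0 i = 0.
Proof.
move=> My Wt i ai; have [_ [PsiB _ _ _] _ _ dP] := lc.
pose w (t : R) := Psi (Phi t y) 0 i.
have dw (t : R) : 0 <= t -> is_derive t 1 w (a i * w t).
  move=> t0; have Mt := flow_in flow t My.
  have := is_derive_mx_coord (dP _ Mt (Wt t t0)) 0 i; rewrite mxE => d.
  have := @is_derive_affine R _ (fun s => Psi (Phi s (Phi t y)) 0 i) 1 (- t) t (a i * w t).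
  rewrite mul1r subrr scale1r => /(_ d).
  congr (is_derive _ _ _ _); apply/funext => s.
  by rewrite mul1r /w (flow_add flow)// subrK.
(* The factor [s] lets the one-sided [derive_le0_le], used at [1] and [-1], prove constancy. *)
pose g (s : R) (t : R) := s * (w t * expR (- a i * t)).
have dg (s t : R) : 0 <= t -> is_derive t 1 (g s) 0.
  move=> t0.
  have d1 : is_derive t 1 (fun r : R => - a i * r) (- a i).
    apply: (is_derive_eq (is_deriveZ (- a i) (is_derive_id t (1 : R)))).
    by rewrite /GRing.scale/= mulr1.
  have d2 : is_derive t 1 (fun r => expR (- a i * r)) (- a i * expR (- a i * t)).
    by apply: is_derive_eq; ring.
  apply: (is_derive_eq (is_deriveZ s (is_deriveM (dw t t0) d2))).
  by rewrite /GRing.scale/=; ring.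
have wE (T : R) : 0 <= T -> w T * expR (- a i * T) = w 0.
  move=> T0; have gle s : g s T <= g s 0.
    apply: (@derive_le0_le _ _ (fun=> 0)) T0 _ => t /andP[t0 _].
    by split=> //; exact: dg.
  have := gle 1; have := gle (-1); rewrite /g !mulr0 expR0 !mulN1r !mul1r mulr1 lerN2.
  by move=> h1 h2; apply/eqP; rewrite eq_le h1 h2.
have w1 (t : R) : 0 <= t -> `|w t| <= 1.
  move=> t0; apply: unit_ball_coord.
  by have [] := PsiB _ (conj (flow_in flow t My) (Wt t t0)).
have -> : Psi y 0 i = w 0 by rewrite /w (flow0 flow).
apply/eqP; rewrite -normr_le0; apply/ler_addgt0Pr => e e0; rewrite add0r.
(* At this time the exponential is [expR (- e^-1)], at most [e] because [expR x] is at least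
   [1 + x]. *)
pose T := (a i * e)^-1; have T0 : 0 < T by rewrite invr_gt0 mulr_gt0.
rewrite -(wE T (ltW T0)) normrM (ger0_norm (expR_ge0 _)).
rewrite (@le_trans _ _ (expR (- a i * T)))//.
  by rewrite ler_piMl ?expR_ge0// w1// ltW.
rewrite mulNr expRN -[leRHS]invrK lef_pV2 ?posrE ?expR_gt0 ?invr_gt0//.
have -> : e^-1 = a i * T.
  by rewrite /T; field; rewrite !gt_eqF.
by rewrite (le_trans _ (expR_ge1Dx _))// lerDr.
Qed.

End LinearCharts.

(** * Strict differentiability *)

Section StrictDifferentiability.
Variable R : realType.

(** With two moving points, the estimate at [x] alone controls injectivity near [x], and it makes
    sense on a set [A] that need not be open. *)
Definition strict_diff p q (A : set 'rV[R]_p) (h : 'rV[R]_p -> 'rV[R]_q) x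
    (J : 'M[R]_(p, q)) : Prop :=
  forall eps, 0 < eps -> exists2 d, 0 < d & forall a b,
    A a -> A b -> ball x d a -> ball x d b ->
    `|h b - h a - (b - a) *m J| <= eps * `|b - a|.

Lemma jet_strict p q (A : set 'rV[R]_p) (h : 'rV[R]_p -> 'rV[R]_q) x d K J :
  jet A h x d K J -> strict_diff A h x (J x).
Proof.
move=> [d0 K0 JK taylor _] eps eps0.
have p0 : 0 <= p%:R :> R by [].
(* The Taylor term costs [2 * K], since [b - a] is at most twice the radius; moving the Jacobian
   from [a] to [x] costs [p%:R * K]. *)
pose c := (2 + p%:R) * (K + 1); have c0 : 0 < c by rewrite mulr_gt0//; lra.
exists (Num.min d (eps / c)); first by rewrite lt_min d0 divr_gt0.
have sub a : ball x (Num.min d (eps / c)) a -> ball x d a /\ `|a - x| < eps / c.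
  by rewrite -!ball_normE/= lt_min distrC => /andP[].
move=> a b Aa Ab /sub[xa ax] /sub[xb bx].
have t1 := taylor a b xa xb Aa Ab.
have t2 := JK x a (ballxx x d0) xa.
have t3 := mx_norm_mul (b - a) (J a - J x).
have ab : `|b - a| <= 2 * (eps / c).
  have := ler_distD x b a; rewrite (distrC x a); lra.
have E : h b - h a - (b - a) *m J x =
    (h b - h a - (b - a) *m J a) + (b - a) *m (J a - J x).
  by rewrite mulmxBr addrA subrK.
rewrite E (le_trans (ler_normD _ _))//.
set r := `|b - a| in t1 t3 ab *.
have r0 : 0 <= r by exact: normr_ge0.
have u1 : K * r ^+ 2 <= K * (2 * (eps / c)) * r.
  by rewrite (_ : K * r ^+ 2 = K * r * r) ?ler_wpM2r ?ler_wpM2l//; ring.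
have u2 : p%:R * (r * `|J a - J x|) <= p%:R * (K * (eps / c)) * r.
  rewrite (_ : p%:R * (K * (eps / c)) * r = p%:R * (r * (K * (eps / c)))); last by ring.
  by rewrite !ler_wpM2l// (le_trans t2)// ler_wpM2l// ltW.
have u3 : K * (2 * (eps / c)) + p%:R * (K * (eps / c)) <= eps.
  have -> : K * (2 * (eps / c)) + p%:R * (K * (eps / c)) =
      (eps / c) * ((2 + p%:R) * K) by ring.
  rewrite mulrAC ler_pdivrMr// ler_wpM2l ?(ltW eps0)//.
  by rewrite /c; nra.
have := ler_wpM2r r0 u3; rewrite mulrDl; lra.
Qed.

Lemma strict_diff_comp p q r (A : set 'rV[R]_p) (B : set 'rV[R]_q)
    (h : 'rV[R]_p -> 'rV[R]_q) (g : 'rV[R]_q -> 'rV[R]_r) x J J' :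
  A x -> (forall a, A a -> B (h a)) ->
  strict_diff A h x J -> strict_diff B g (h x) J' ->
  strict_diff A (g \o h) x (J *m J').
Proof.
move=> Ax AB hJ gJ eps eps0.
pose L := p%:R * `|J| + 1.
have L0 : 1 <= L by rewrite lerDr mulr_ge0.
have hlip : exists2 d, 0 < d & forall a b, A a -> A b -> ball x d a ->
    ball x d b -> `|h b - h a| <= L * `|b - a|.
  have [d d0 dP] := hJ 1 ltr01; exists d => // a b Aa Ab xa xb.
  have := dP a b Aa Ab xa xb.
  have := mx_norm_mul (b - a) J.
  have : `|h b - h a| <= `|h b - h a - (b - a) *m J| + `|(b - a) *m J|.
    by rewrite -{1}(subrK ((b - a) *m J) (h b - h a)) ler_normD.
  by rewrite /L mulrDl !mul1r mulrA (mulrAC _ `|b - a|); lra.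
have [d1 d10 lip] := hlip.
pose N := q%:R * `|J'| + 1.
have N0 : 1 <= N by rewrite lerDr mulr_ge0.
have e1 : 0 < eps / (2 * L) by rewrite divr_gt0//; lra.
have e2 : 0 < eps / (2 * N) by rewrite divr_gt0//; lra.
have [d2 d20 gP] := gJ _ e1; have [d3 d30 hP] := hJ _ e2.
pose d := Num.min (Num.min d1 d3) (d2 / L).
have L00 : 0 < L by lra.
exists d; first by rewrite !lt_min d10 d30 divr_gt0.
have sub a : A a -> ball x d a -> [/\ ball x d1 a, ball x d3 a & ball (h x) d2 (h a)].
  move=> Aa; rewrite -!ball_normE/= !lt_min => /andP[/andP[xa1 xa3] xa2].
  split=> //; rewrite distrC (le_lt_trans (lip x a Ax Aa _ _))//.
  - exact: ballxx.
  - by rewrite -ball_normE.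
  - by rewrite mulrC -ltr_pdivlMr// distrC.
move=> a b Aa Ab /(sub _ Aa)[xa1 xa3 ya] /(sub _ Ab)[xb1 xb3 yb].
have t1 := gP _ _ (AB _ Aa) (AB _ Ab) ya yb.
have t2 := hP _ _ Aa Ab xa3 xb3.
have t3 := lip _ _ Aa Ab xa1 xb1.
have E : (g \o h) b - (g \o h) a - (b - a) *m (J *m J') =
    (g (h b) - g (h a) - (h b - h a) *m J') +
    (h b - h a - (b - a) *m J) *m J'.
  by rewrite /= [X in _ = _ + X]mulmxBl mulmxA addrA subrK.
rewrite E (le_trans (ler_normD _ _))// [eps]splitr mulrDl lerD//.
  rewrite (le_trans t1)// (@le_trans _ _ (eps / (2 * L) * (L * `|b - a|)))//.
    by rewrite ler_wpM2l// ltW.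
  by rewrite mulrA (_ : eps / (2 * L) * L = eps / 2)//; field; rewrite gt_eqF.
rewrite (le_trans (mx_norm_mul _ _))// mulrCA mulrC.
rewrite (@le_trans _ _ (N * (eps / (2 * N) * `|b - a|)))//.
  by rewrite ler_pM ?mulr_ge0// /N lerDl.
by rewrite mulrA (_ : N * (eps / (2 * N)) = eps / 2)//; field; rewrite gt_eqF//; lra.
Qed.

(** Vectors being rows, [T] inverts [J]; the precision [(2 * c)^-1] makes the error after [T] at
    most half of [b - a]. Only the image of [h b - h a] under [T] is assumed to vanish, so agreement
    in some coordinates can suffice. *)
Lemma strict_diff_injective p q (A : set 'rV[R]_p) (h : 'rV[R]_p -> 'rV[R]_q) x
    (J : 'M[R]_(p, q)) (T : 'M[R]_(q, p)) :
  strict_diff A h x J -> J *m T = 1%:M ->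
  exists2 d, 0 < d & forall a b, A a -> A b -> ball x d a -> ball x d b ->
    (h b - h a) *m T = 0 -> a = b.
Proof.
move=> hJ JT; pose c := q%:R * `|T| + 1.
have c0 : 0 < c by rewrite ltr_wpDl// mulr_ge0.
have c2 : 0 < (2 * c)^-1 by rewrite invr_gt0 mulr_gt0.
have [d d0 hP] := hJ _ c2.
exists d => // a b Aa Ab xa xb hT; apply/esym/eqP; rewrite -subr_eq0 -normr_le0.
have t1 := hP a b Aa Ab xa xb.
have E : (h b - h a - (b - a) *m J) *m T = - (b - a).
  by rewrite mulmxBl hT -mulmxA JT mulmx1 sub0r.
have := mx_norm_mul (h b - h a - (b - a) *m J) T; rewrite E normrN.
set r := `|b - a| in t1 *; set s := `|_ - _ *m J| in t1 * => t2.
have s0 : 0 <= s by exact: normr_ge0.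
have t3 : r <= c * s.
  by rewrite (le_trans t2)// /c mulrDl mul1r (mulrC s) mulrA lerDl.
have t4 : c * s <= c * ((2 * c)^-1 * r) by rewrite ler_wpM2l// ltW.
have t5 : c * ((2 * c)^-1 * r) = r / 2 by field; rewrite gt_eqF.
lra.
Qed.

End StrictDifferentiability.

(** * Stable manifolds *)

Lemma jet_sub (R : realType) p q (A' A : set 'rV[R]_p) (h : 'rV[R]_p -> 'rV[R]_q)
    x d K J : A' `<=` A -> jet A h x d K J -> jet A' h x d K J.
Proof.
move=> AA [d0 K0 JK taylor dh]; split=> // [y z xy xz /AA Ay /AA Az|c t v xc Ac].
  exact: taylor.
by apply: dh => //; apply: filterS Ac => s /AA.
Qed.

Section StableManifold.
Variables (R : realType) (n m : nat) (M : set 'rV[R]_n).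
Variables (xi : 'rV[R]_n -> 'rV[R]_n) (Phi : R -> 'rV[R]_n -> 'rV[R]_n).
Hypothesis flow : regular_flow M xi Phi.

Lemma cvg_shift_pinfty (T : R) : (t + T) @[t --> +oo] --> +oo.
Proof.
apply/cvgryPge => A; near=> t; rewrite -lerBlDr.
by near: t; apply: nbhs_pinfty_ge; exact: num_real.
Unshelve. all: by end_near. Qed.

Lemma stable_flow T q z : M z -> stable M Phi q (Phi T z) <-> stable M Phi q z.
Proof.
move=> Mz.
have fwd (S : R) y : M y -> stable M Phi q y -> stable M Phi q (Phi S y).
  move=> My [_ yq]; split; first exact: (flow_in flow).
  have -> : (fun t => Phi t (Phi S y)) = (Phi ^~ y) \o (fun t => t + S).
    by apply/funext => t; rewrite (flow_add flow).
  exact: cvg_comp (cvg_shift_pinfty S) yq.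
split; last exact: fwd.
move=> /(fwd (- T)); rewrite (flow_add flow)// addNr (flow0 flow)//.
by apply; exact: (flow_in flow).
Qed.

Variables (q : 'rV[R]_n) (W : set 'rV[R]_n) (Psi : 'rV[R]_n -> 'rV[R]_m).
Variables (psi : 'rV[R]_m -> 'rV[R]_n) (a : 'I_m -> R).
Hypothesis lc : linear_chart M Phi q W Psi psi a.

Lemma stable_fixed : stable M Phi q q.
Proof.
rewrite -{2}(linear_chart_psi0 lc); apply: (linear_chart_stable flow lc).
  exact: unit_ball0.
by move=> i _; rewrite mxE.
Qed.

(** A straight line in the subspace of contracted coordinates is sent by [psi] into the stable
    set. *)
Lemma stable_disc_tangent x d K Q (u w : 'rV[R]_m) : jet (@unit_ball R m) psi x d K Q ->
  unit_ball u -> ball x d u -> (forall i, 0 <= a i -> u 0 i = 0) ->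
  (forall i, 0 <= a i -> w 0 i = 0) ->
  tangent (stable M Phi q) (psi u) (w *m Q u).
Proof.
move=> jQ Bu xu u0 w0.
pose N := [set z : 'rV[R]_m | forall i, 0 <= a i -> z 0 i = 0].
have jQ' : jet (@unit_ball R m `&` N) psi x d K Q by apply: jet_sub jQ => z [].
have cl : curve_in (@unit_ball R m `&` N) u w (fun s : R => u + s *: w).
  apply: curve_in_near (curve_in_line w (@unit_ball_open R m) Bu).
  apply: (@filterE _ (nbhs (0 : R))) => s i ai.
  by rewrite !mxE u0// w0// mulr0 addr0.
have psiN z : (@unit_ball R m `&` N) z -> stable M Phi q (psi z).
  by move=> [Bz Nz]; exact: (linear_chart_stable flow lc).
by eexists; exact: curve_comp jQ' psiN xu cl.
Qed.

Variables (k : nat) (X : set 'rV[R]_n).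
Hypotheses (km : (k <= m)%N) (ak : forall i : 'I_m, (i < k)%N -> a i < 0).
Hypotheses (XM : X `<=` M) (stableX : stable M Phi q `<=` X).
Hypothesis Xk : submanifold (@C2 R) k X.

Lemma disc_coord0 (u : 'rV[R]_k) (i : 'I_m) :
  0 <= a i -> (u *m pid_mx k : 'rV[R]_m) 0 i = 0.
Proof.
move=> ai; have ki : (k <= i)%N by rewrite leqNgt; apply/negP => /ak; rewrite ltNge ai.
rewrite mxE big1// => l _; rewrite mxE.
have [li|] := eqVneq (l : nat) i; last by rewrite mulr0.
by have := ltn_ord l; rewrite li ltnNge ki.
Qed.

Lemma stable_disc (u : 'rV[R]_k) : unit_ball (u *m pid_mx k : 'rV[R]_m) ->
  stable M Phi q (psi (u *m pid_mx k)).
Proof.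
by move=> Bu; apply: (linear_chart_stable flow lc) => // i; exact: disc_coord0.
Qed.

(* The chart of [X] at [q] composed with the parametrization of the local
   stable disc has a left inverse, which is injective near [q] because its
   derivative is a square matrix with a left inverse; hence the disc already
   fills a neighbourhood of [q] in [X]. *)
Lemma stable_locally_full : \forall z \near q, X z -> stable M Phi q z.
Proof.
have [[oW Wq] PPsi Mq Psi0 _] := lc.
have [PsiB psiM rPsi rpsi] := PPsi.
have psi0 := linear_chart_psi0 lc.
have Xq : X q by apply: stableX; exact: stable_fixed.
have [phi [psi' [W' [V [oW' W'q oV diff']]]]] := Xk Xq.
have [phiV psiX rphi rpsi'] := diff'.
have [Vq psi'q] := phiV q (conj Xq W'q).
set v0 := phi q in Vq psi'q *.
have B0 := @unit_ball0 R m.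
have [d1 [K1 [P0 jP0]]] := regular_jet rPsi (conj Mq Wq).
have [d2 [K2 [Q0 jQ0]]] := regular_jet rpsi B0.
have [d3 [K3 [P1 jP1]]] := regular_jet rphi (conj Xq W'q).
have [d4 [K4 [Q1 jQ1]]] := regular_jet rpsi' Vq.
have [d10 d20 d30 d40] : [/\ 0 < d1, 0 < d2, 0 < d3 & 0 < d4].
  by move: jP0 jQ0 jP1 jQ1 => [? _ _ _ _] [? _ _ _ _] [? _ _ _ _] [? _ _ _ _].
have bq1 := ballxx q d10; have bq3 := ballxx q d30.
have b02 := ballxx (0 : 'rV[R]_m) d20; have bv4 := ballxx v0 d40.
pose iota : 'M[R]_(k, m) := pid_mx k; pose pi : 'M[R]_(m, k) := pid_mx k.
have iotapi : iota *m pi = 1%:M.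
  by rewrite /iota /pi pid_mx_id// pid_mx_1.
(* The first factor is the differential of the disc read in the chart [phi] of [X]; the second is
   that of [psi'], then [Psi], then the first [k] coordinates. Both are square, so the product can
   be reversed in [DS]. *)
have SD : (iota *m Q0 0 *m P1 q) *m (Q1 v0 *m P0 q *m pi) = 1%:M.
  apply/row_matrixP => i; set e := delta_mx 0 i : 'rV[R]_k.
  rewrite 2!rowE -/e mulmx1 !mulmxA.
  have c1 : tangent X q (e *m iota *m Q0 0).
    apply: (tangent_sub stableX); rewrite -{2}psi0.
    apply: (stable_disc_tangent jQ0) => //; [by move=> l _; rewrite mxE|].
    exact: disc_coord0.
  rewrite -(chart_tangentE oW' diff' jP1 jQ1 W'q bq3 bv4 c1).
  have := @chart_jet_inv R n m M W (@unit_ball R m) Psi psi (@unit_ball_open R m)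
    PPsi q d1 K1 P0 0 d2 K2 Q0 jP0 jQ0 q Mq Wq bq1.
  rewrite Psi0 => /(_ b02 (e *m iota)) ->.
  by rewrite -mulmxA iotapi mulmx1.
have DS := mulmx1C SD.
have JT : (Q1 v0 *m P0 q) *m (pi *m (iota *m Q0 0 *m P1 q)) = 1%:M.
  by rewrite mulmxA.
pose A := V `&` [set v | W (psi' v)].
have Av0 : A v0 by split => //=; rewrite psi'q.
have sG : strict_diff A (Psi \o psi') v0 (Q1 v0 *m P0 q).
  apply: (@strict_diff_comp _ _ _ _ _ (M `&` W)) => //.
  - by move=> v [/psiX[[Xv _] _] Wv]; split => //; exact: XM.
  - move=> eps eps0; have [d d0 dP] := jet_strict jQ1 eps0.
    by exists d => // y z [Vy _] [Vz _]; exact: dP.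
  - by rewrite psi'q; exact: jet_strict jP0.
have [d d0 inj] := strict_diff_injective sG JT.
pose F := within X (nbhs q).
have FF : Filter F by exact: within_filter.
have idF : z @[z --> F] --> q by exact: cvg_within.
have XF : \forall z \near F, X z by exact: withinT.
have WF : \forall z \near F, W z by apply: idF; exact: open_nbhs_nbhs.
have W'F : \forall z \near F, W' z by apply: idF; exact: open_nbhs_nbhs.
have MWF : \forall z \near F, (M `&` W) z.
  by near=> z; split; [apply: XM|]; near: z.
have XWF : \forall z \near F, (X `&` W') z by near=> z; split; near: z.
have phiF : phi z @[z --> F] --> v0 by apply: regular_cvg rphi _ XWF idF.
have PsiF : Psi z @[z --> F] --> (0 : 'rV[R]_m).
  by rewrite -Psi0; apply: regular_cvg rPsi _ MWF idF.
(* [psi (w z)] is the disc point with the same first [k] coordinates as [z]; it will turn out to be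
   [z]. *)
pose w z := Psi z *m pi *m iota.
have wF : w z @[z --> F] --> (0 : 'rV[R]_m).
  rewrite -[X in _ --> X](_ : 0 *m pi *m iota = 0); last by rewrite !mul0mx.
  apply: cvg_mulmx; last exact: cvg_cst.
  by apply: cvg_mulmx; [exact: PsiF|exact: cvg_cst].
have BwF : \forall z \near F, unit_ball (w z).
  have nB : nbhs (0 : 'rV[R]_m) (@unit_ball R m).
    by apply: open_nbhs_nbhs; split=> //; exact: unit_ball_open.
  exact: (wF _ nB).
have psiwF : psi (w z) @[z --> F] --> q.
  by rewrite -psi0; apply: regular_cvg rpsi _ BwF wF.
have XpsiF : \forall z \near F, X (psi (w z)).
  by apply: filterS BwF => z Bz; apply: stableX; apply: stable_disc.
have W'psiF : \forall z \near F, W' (psi (w z)) by apply: psiwF; exact: open_nbhs_nbhs.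
have phipsiF : phi (psi (w z)) @[z --> F] --> v0.
  have XW : \forall z \near F, (X `&` W') (psi (w z)) by near=> z; split; near: z.
  exact: (regular_cvg FF rphi (conj Xq W'q) XW psiwF).
have dF1 : \forall z \near F, ball v0 d (phi z).
  exact: (phiF _ (nbhsx_ballx v0 d d0)).
have dF2 : \forall z \near F, ball v0 d (phi (psi (w z))).
  exact: (phipsiF _ (nbhsx_ballx v0 d d0)).
suff : \forall z \near F, stable M Phi q z by [].
near=> z.
have [Xz Wz W'z] : [/\ X z, W z & W' z] by split; near: z.
have Bz : unit_ball (w z) by near: z.
have Xy : X (psi (w z)) by near: z.
have W'y : W' (psi (w z)) by near: z.
have [Vz Ez] := phiV z (conj Xz W'z).
have [Vy Ey] := phiV _ (conj Xy W'y).
have [[My Wy] PsiE] := psiM _ Bz.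
(* Both points agree in the coordinates kept by [pi], and the inverse used in [JT] begins with
   [pi]. *)
have E : phi z = phi (psi (w z)).
  apply: inj; [by split=> //=; rewrite Ez|by split=> //=; rewrite Ey|by near: z|by near: z|].
  rewrite /= Ez Ey PsiE !mulmxA.
  suff -> : (w z - Psi z) *m pi = 0 by rewrite !mul0mx.
  have -> : (w z - Psi z) *m pi = Psi z *m pi *m (iota *m pi) - Psi z *m pi.
    by rewrite mulmxBl /w mulmxA.
  by rewrite iotapi mulmx1 subrr.
rewrite -Ez E Ey; exact: stable_disc.
Unshelve. all: by end_near. Qed.

Hypothesis Xflow : forall t z, X z -> X (Phi t z).

(** [Phi T] pushes a curve of [X] into the neighbourhood of [q] where [X] lies in the stable set;
    both sets are invariant, so the curve was in the stable set for small times. *)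
Lemma tangent_stable x : stable M Phi q x -> tangent X x `<=` tangent (stable M Phi q) x.
Proof.
move=> sx v [c cX]; exists c.
suff : \forall s \near (0 : R), X (c s) -> stable M Phi q (c s).
  move=> nc; have Xc : curve_in (X `&` (stable M Phi q)) x v c.
    have [e e0 [_ Xe _ _]] := cX.
    apply: curve_in_near cX; have := nbhsx_ballx (0 : R) e e0 => be.
    by apply: filterS2 nc be => s h /Xe.
  by apply: curve_in_sub Xc => z [].
have [Mx xq] := sx.
have sf : nbhs q [set z | X z -> stable M Phi q z] := stable_locally_full.
rewrite nbhsE in sf; have [V [oV Vq] VX] := sf.
have [T TV] : exists T, V (Phi T x).
  have : \forall t \near +oo, V (Phi t x) by apply: xq; exact: open_nbhs_nbhs.
  by move=> /filter_ex.
have Xc0 : \forall s \near (0 : R), X (c s).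
  have [e e0 [_ Xe _ _]] := cX; have := nbhsx_ballx (0 : R) e e0.
  by apply: filterS => s /Xe.
have cx : c s @[s --> (0 : R)] --> x.
  have cc := curve_in_continuous cX; have [_ _ [_ _ c0 _]] := cX.
  by rewrite -c0; exact: cc.
have Mc : \forall s \near (0 : R), M (c s) by apply: filterS Xc0 => s /XM.
have Tc : Phi T (c s) @[s --> (0 : R)] --> Phi T x.
  exact: (flow_continuous flow _ Mx Mc cx).
have : \forall s \near (0 : R), V (Phi T (c s)).
  by apply: Tc; exact: open_nbhs_nbhs.
apply: filterS => s Vs Xs.
by apply/(stable_flow T); [exact: XM|apply: VX => //; exact: Xflow].
Qed.

End StableManifold.

(** * Transversality near a critical point *)

(* [edist] alone now denotes the library's extended distance. *)
Notation edist := Defs.edist.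

Section Gap.
Variables (R : realType) (n : nat).
Implicit Types (U V : set 'rV[R]_n) (u v : 'rV[R]_n).

Lemma norm_le_enorm u : `|u| <= enorm u.
Proof.
by rewrite sqnorm_enorm -ler_sqr ?nnegrE ?sqrtr_ge0// sqr_sqrtr ?sqnorm_ge0// sqnorm_ge.
Qed.

Lemma enorm_le_norm u : enorm u <= n.+1%:R * `|u|.
Proof.
rewrite sqnorm_enorm -ler_sqr ?nnegrE ?sqrtr_ge0 ?mulr_ge0// sqr_sqrtr ?sqnorm_ge0//.
rewrite (le_trans (sqnorm_le _))// exprMn ler_wpM2r ?sqr_ge0//.
by rewrite -natrX ler_nat (leq_trans (leqnSn n))// expnS expn1 leq_pmulr.
Qed.

Lemma enormZ (c : R) u : enorm (c *: u) = `|c| * enorm u.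
Proof.
rewrite !sqnorm_enorm -sqrtr_sqr -sqrtrM ?sqr_ge0//; congr Num.sqrt.
by rewrite /sqnorm mulr_sumr; apply: eq_bigr => i _; rewrite mxE exprMn.
Qed.

Lemma enorm0 : enorm (0 : 'rV[R]_n) = 0.
Proof. by rewrite -(scale0r 0) enormZ normr0 mul0r. Qed.

(** Scale [u] to length 1, approximate the infimum, scale back. The supremum in [gap] is a true one:
    as [0] is in [V], all distances are at most 1. *)
Lemma gap_approx U V u r : V 0 -> (forall c v, V v -> V (c *: v)) ->
  (forall c v, U v -> U (c *: v)) -> gap U V < r -> U u ->
  exists2 v, V v & `|u - v| <= enorm u * r.
Proof.
move=> V0 VZ UZ gr Uu.
have [u0|u0] := eqVneq u 0.
  by exists 0 => //; rewrite u0 subrr normr0 enorm0 mul0r.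
have nu : 0 < enorm u by rewrite (lt_le_trans _ (norm_le_enorm u))// normr_gt0.
pose e := (enorm u)^-1 *: u.
have e1 : enorm e = 1 by rewrite enormZ gtr0_norm ?invr_gt0// mulVf// gt_eqF.
have Ue : U e by exact: UZ.
have lb w : lbound [set enorm (w - v) | v in V] 0.
  by move=> _ [v _ <-]; exact: sqrtr_ge0.
have ne w : [set enorm (w - v) | v in V] !=set0 by exists (enorm (w - 0)); exists 0.
have hs : has_sup [set edist w V | w in [set w | U w /\ enorm w = 1]].
  split; first by exists (edist e V); exists e.
  exists 1 => _ [w [_ w1] <-]; rewrite /Defs.edist.
  rewrite (@le_trans _ _ (enorm w))//; last by rewrite w1.
  apply: ge_inf; first by exists 0; exact: lb.
  by exists 0 => //; rewrite subr0.
have : edist e V < r.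
  by apply: le_lt_trans gr; apply: sup_upper_bound => //; exists e.
move=> /(inf_lt (ne e))[_ [v Vv <-] evr].
exists (enorm u *: v); first exact: VZ.
have -> : u - enorm u *: v = enorm u *: (e - v).
  by rewrite scalerBr /e scalerA mulfV ?scale1r// gt_eqF.
rewrite normrZ gtr0_norm// ler_wpM2l// ?ltW//.
by rewrite (le_lt_trans (norm_le_enorm _)).
Qed.

End Gap.

(** A kernel row [u] equals [- (u *m (Z - 1%:M))], which is strictly shorter than [u] unless
    [u = 0]. *)
Lemma near_identity_unit (R : realType) m (Z : 'M[R]_m) (e : R) :
  m%:R * e < 1 -> `|Z - 1%:M| <= e -> Z \in unitmx.
Proof.
move=> me Ze; rewrite -row_free_unit -kermx_eq0; apply/eqP/row_matrixP => i.
rewrite row0; set u := row i _.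
have uZ : u *m Z = 0 by rewrite /u -row_mul mulmx_ker row0.
have uE : u = - (u *m (Z - 1%:M)) by rewrite mulmxBr uZ mulmx1 sub0r opprK.
have := mx_norm_mul u (Z - 1%:M); rewrite -normrN -uE => le1.
have le2 : m%:R * (`|u| * `|Z - 1%:M|) <= m%:R * e * `|u|.
  by rewrite -mulrA ler_wpM2l// mulrC ler_wpM2r.
apply/eqP; rewrite -normr_le0 leNgt; apply/negP => u0.
have : m%:R * e * `|u| < `|u| by rewrite gtr_pMl.
by move=> /(le_lt_trans (le_trans le1 le2)); rewrite ltxx.
Qed.

Section LocalTransversality.
Variables (R : realType) (n m : nat) (M : set 'rV[R]_n).
Variables (xi : 'rV[R]_n -> 'rV[R]_n) (Phi : R -> 'rV[R]_n -> 'rV[R]_n).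
Hypothesis flow : regular_flow M xi Phi.
Variables (q : 'rV[R]_n) (W : set 'rV[R]_n) (Psi : 'rV[R]_n -> 'rV[R]_m).
Variables (psi : 'rV[R]_m -> 'rV[R]_n) (a : 'I_m -> R).
Hypothesis lc : linear_chart M Phi q W Psi psi a.
Variables (j k : nat) (X Y : set 'rV[R]_n).
Hypothesis ajP : forall i : 'I_m, (i < j)%N -> 0 < a i.
Hypothesis ajN : forall i : 'I_m, (j <= i)%N -> a i < 0.
Hypotheses (Xj : submanifold (@C2 R) j X) (Yk : submanifold (@C2 R) k Y).
Hypotheses (Xq : X q) (YM : Y `<=` M).
Hypothesis XYq : verdier_at X Y q.
Hypothesis TX : forall d K Q, jet (@unit_ball R m) psi 0 d K Q ->
  forall i : 'I_m, (i < j)%N -> tangent X q (delta_mx 0 i *m Q 0).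

(** In chart coordinates at [y], the rows of [Z] are vectors of [tangent Y y] close to the expanding
    axes at [q], then the contracting axes. As [Z] is invertible, every tangent vector of [M]
    combines these rows: those of index below [j] give [v1], the others [v2]. *)
Lemma local_transversality x : stable M Phi q x -> (forall t, Y (Phi t x)) ->
  exists T, [/\
    forall v w, tangent M (Phi T x) v -> tangent M (Phi T x) w ->
      tangent M (Phi T x) (v + w) &
    forall v, tangent M (Phi T x) v -> exists v1 v2,
      [/\ tangent Y (Phi T x) v1, tangent (stable M Phi q) (Phi T x) v2 &
          v = v1 + v2]].
Proof.
move=> [Mx xq] Yx.
have [[oW Wq] PPsi Mq Psi0 _] := lc.
have [PsiB psiM rPsi rpsi] := PPsi.
have B0 := @unit_ball0 R m.
have oB := @unit_ball_open R m.
have [d1 [K1 [P jP]]] := regular_jet rPsi (conj Mq Wq).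
have [d2 [K2 [Q jQ]]] := regular_jet rpsi B0.
have [d10 _ PK _ _] := jP; have [d20 _ _ _ _] := jQ.
have bq1 := ballxx q d10; have b02 := ballxx (0 : 'rV[R]_m) d20.
pose e i := delta_mx 0 i : 'rV[R]_m.
pose v i := e i *m Q 0.
have vP i : v i *m P q = e i.
  have := @chart_jet_inv R n m M W (@unit_ball R m) Psi psi oB
    PPsi q d1 K1 P 0 d2 K2 Q jP jQ q Mq Wq bq1.
  by rewrite Psi0 => /(_ b02 (e i)) ->.
have v0 i : 0 <= enorm (v i) by exact: sqrtr_ge0.
pose B := \sum_i enorm (v i) + 1.
have sB : 0 <= \sum_i enorm (v i) by apply: sumr_ge0.
have B1 : 1 <= B by rewrite /B lerDr.
have vB i : enorm (v i) <= B.
  rewrite /B (bigD1 i)//= -addrA lerDl addr_ge0//.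
  by apply: sumr_ge0.
pose PB := `|P q| + 1; have PB1 : 1 <= PB by rewrite /PB lerDr.
pose N : R := n.+1%:R; have N1 : 1 <= N by rewrite /N ler1n.
have nN : n%:R <= N by rewrite /N ler_nat.
(* Small enough for [m%:R * eps < 1], as [near_identity_unit] demands. *)
pose eps : R := (2 * m.+1%:R)^-1.
have m10 : 0 < m.+1%:R :> R by [].
have eps0 : 0 < eps by rewrite invr_gt0 mulr_gt0.
have meps : m%:R * eps < 1.
  rewrite /eps ltr_pdivrMr ?mulr_gt0// mul1r.
  have : m%:R < m.+1%:R :> R by rewrite ltr_nat.
  by move: m10; lra.
(* [r] bounds the gap and [rho] the variation of [P]; each error gets half of [eps] in the estimate
   of a row of [Z]. *)
pose r := eps / (2 * N * B * PB).
have den0 : 0 < 2 * N * B * PB by rewrite !mulr_gt0//; lra.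
have r0 : 0 < r by rewrite divr_gt0.
pose rho := Num.min 1 (eps / (2 * N * B)).
have den1 : 0 < 2 * N * B by rewrite !mulr_gt0//; lra.
have rho0 : 0 < rho by rewrite lt_min ltr01 divr_gt0.
have [U [C [oU Uq C0 ver]]] := XYq.
have near_y (S : set 'rV[R]_n) : nbhs q S -> \forall t \near +oo, S (Phi t x).
  by move=> qS; exact: (xq S qS).
have [T0 TW] : exists T0 : R, forall t, T0 < t -> W (Phi t x).
  have [T0 [_ TW]] := near_y W (open_nbhs_nbhs (conj oW Wq)).
  by exists T0 => t /TW.
have K10 : 0 <= K1 by have [_ ? _ _ _] := jP.
have K11 : 0 < K1 + 1 by lra.
have rK : 0 < rho / (K1 + 1) by rewrite divr_gt0.
have CN : 0 < C * N by rewrite mulr_gt0//; lra.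
have rC : 0 < r / (C * N) by rewrite divr_gt0.
(* [T0 < T] keeps the whole forward orbit of [y] in [W], which makes its expanding coordinates
   vanish. *)
have [T [Tgt [UT bT QT PT gT]]] : exists T, T0 < T /\
    [/\ U (Phi T x), ball q d1 (Phi T x), ball 0 d2 (Psi (Phi T x)),
        `|P (Phi T x) - P q| <= rho & C * enorm (q - Phi T x) < r].
  apply: (@filter_ex _ (pinfty_nbhs R)).
  have MW : \forall t \near +oo, (M `&` W) (Phi t x).
    exists T0; split; first exact: num_real.
    by move=> t /TW; split=> //; exact: (flow_in flow).
  have PsiT : Psi (Phi t x) @[t --> +oo] --> (0 : 'rV[R]_m).
    by rewrite -Psi0; exact: (regular_cvg _ rPsi (conj Mq Wq) MW xq).
  have c1 : `|Phi t x - q| @[t --> +oo] --> (0 : R).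
    by apply/norm_cvg0P/subr_cvg0.
  have small (s : R) : 0 < s -> \forall t \near +oo, `|Phi t x - q| < s.
    by move=> s0; exact: (cvgr_lt _ c1 _ s0).
  near=> t; split.
    by near: t; apply: nbhs_pinfty_gt; exact: num_real.
  have tb : ball q d1 (Phi t x) by near: t; apply: near_y; exact: nbhsx_ballx.
  split=> //.
  - by near: t; apply: near_y; exact: open_nbhs_nbhs.
  - near: t; exact: (PsiT _ (nbhsx_ballx (0 : 'rV[R]_m) d2 d20)).
  - rewrite (le_trans (PK _ _ bq1 tb))//.
    have : `|Phi t x - q| < rho / (K1 + 1) by near: t; exact: small.
    rewrite ltr_pdivlMr//.
    by have := normr_ge0 (Phi t x - q); lra.
  - have : `|Phi t x - q| < r / (C * N) by near: t; exact: small.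
    rewrite ltr_pdivlMr//.
    apply: le_lt_trans; rewrite mulrCA ler_wpM2l ?(ltW C0)// mulrC distrC.
    exact: enorm_le_norm.
exists T; set y := Phi T x in UT bT QT PT gT *.
have My : M y by exact: (flow_in flow).
have Wy : W y by exact: TW.
have Yy : Y y by exact: Yx.
have [By psiy] := PsiB y (conj My Wy).
have TME := chart_tangentE oW PPsi jP jQ Wy bT QT.
have TMim := chart_tangent_image oB PPsi jQ My Wy QT.
split=> [v' w' /TME -> /TME ->|s /TME sE].
  by rewrite -mulmxDl; exact: TMim.
have Psiy i : 0 < a i -> Psi y 0 i = 0.
  apply: (linear_chart_trapped flow lc) => // t t0.
  by rewrite /y (flow_add flow)//; apply: TW; lra.
have TY_lin := submanifold_tangent_lin Yk Yy.
have TX_lin := submanifold_tangent_lin Xj Xq.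
have TY0 := tangent0 Yy; have TX0 := tangent0 Xq.
have approx (i : 'I_m) : exists w, tangent Y y w /\
    ((i < j)%N -> `|v i - w| <= enorm (v i) * r).
  case: (ltnP i j) => ij; last by exists 0.
  have [w Tw vw] := @gap_approx R n (tangent X q) (tangent Y y) (v i) r TY0
    (fun c z Tz => eq_ind _ (tangent Y y) (TY_lin c z 0 Tz TY0) _ (addr0 _))
    (fun c z Tz => eq_ind _ (tangent X q) (TX_lin c z 0 Tz TX0) _ (addr0 _))
    (le_lt_trans (ver q y Uq Xq UT Yy) gT) (TX jQ ij).
  by exists w.
pose w i := sval (cid (approx i)).
have Tw i : tangent Y y (w i) by have [] := svalP (cid (approx i)).
have vw (i : 'I_m) : (i < j)%N -> `|v i - w i| <= enorm (v i) * r.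
  by have [] := svalP (cid (approx i)).
pose Z : 'M[R]_m := \matrix_i (if (i < j)%N then w i *m P y else e i).
have Z1 : `|Z - 1%:M| <= eps.
  apply: mx_norm_le => [|i l]; first exact: ltW.
  have -> : (Z - 1%:M) i l = row i (Z - 1%:M) 0 l by rewrite [RHS]mxE.
  rewrite linearB/= rowK row1 -/(e i).
  case: ifPn => ij; last by rewrite subrr mxE normr0 ltW.
  rewrite (le_trans (mx_norm_coord _ _ _))//.
  have -> : w i *m P y - e i = v i *m (P y - P q) - (v i - w i) *m P y.
    rewrite -(vP i) mulmxBr mulmxBl.
    move: (v i *m P y) (v i *m P q) (w i *m P y) => A1 A2 A3.
    by apply/matrixP => i' l'; rewrite !mxE; ring.
  rewrite (le_trans (ler_normB _ _))//.
  have Py : `|P y| <= PB.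
    have : rho <= 1 by rewrite /rho ge_min lexx.
    have := ler_normD (P y - P q) (P q); rewrite subrK /PB; lra.
  have rhoE : rho <= eps / (2 * N * B) by rewrite /rho ge_min lexx orbT.
  rewrite [leRHS](splitr eps) lerD//.
    rewrite (le_trans (mx_norm_mul _ _))//.
    rewrite (@le_trans _ _ (N * (B * (eps / (2 * N * B)))))//.
      rewrite ler_pM ?mulr_ge0// ler_pM//; last exact: le_trans rhoE.
      by rewrite (le_trans (norm_le_enorm _)).
    by rewrite le_eqVlt; apply/orP; left; apply/eqP; field; rewrite !gt_eqF//; lra.
  rewrite (le_trans (mx_norm_mul _ _))//.
  rewrite (@le_trans _ _ (N * (B * r * PB)))//.
    rewrite ler_pM ?mulr_ge0// ler_pM//.
    by rewrite (le_trans (vw i ij))// ler_wpM2r// ltW.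
  rewrite /r le_eqVlt; apply/orP; left; apply/eqP; field.
  by rewrite !gt_eqF//; lra.
have Zu := near_identity_unit meps Z1.
pose c := s *m P y *m invmx Z.
have cZ : s *m P y = c *m Z by rewrite /c mulmxKV.
pose s2 : 'rV[R]_m := \row_i (if (i < j)%N then 0 else c 0 i).
pose s1 : 'rV[R]_n := \sum_(i < m) (if (i < j)%N then c 0 i else 0) *: w i.
exists s1, (s2 *m Q (Psi y)); split.
- exact: submanifold_tangent_sum Yk Yy Tw.
- rewrite -{1}psiy; apply: (stable_disc_tangent flow lc jQ) => // i ai.
    have [ij|ij] := ltnP i j; first by rewrite Psiy// ajP.
    by have := ajN ij; rewrite ltNge ai.
  rewrite mxE; case: ltnP => // ij.
  by have := ajN ij; rewrite ltNge ai.
rewrite sE cZ.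
have -> : c *m Z = s1 *m P y + s2.
  rewrite mulmx_sum_row /s1 mulmx_suml.
  have -> : s2 = \sum_(i < m) (if (i < j)%N then 0 else c 0 i) *: e i.
    by rewrite [LHS]row_sum_delta; apply: eq_bigr => i _; rewrite mxE.
  rewrite -big_split/=; apply: eq_bigr => i _.
  rewrite rowK; case: ifP => _; first by rewrite scale0r addr0 scalemxAl.
  by rewrite scale0r mul0mx add0r.
rewrite mulmxDl; congr (_ + _).
(* Each [w i] is tangent to [M] too, so going through the chart and back leaves it unchanged. *)
rewrite /s1 !mulmx_suml; apply: eq_bigr => i _.
rewrite -!scalemxAl; congr (_ *: _).
by apply/esym; apply: TME; exact: (tangent_sub YM).
Unshelve. all: by end_near. Qed.

End LocalTransversality.

(** * Morse flows *)

Section MorseFlows.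
Variables (R : realType) (n m : nat) (M : set 'rV[R]_n).
Variables (f : 'rV[R]_n -> R^o) (xi : 'rV[R]_n -> 'rV[R]_n).
Variable Phi : R -> 'rV[R]_n -> 'rV[R]_n.
Hypotheses (Mcompact : compact M) (fxi : morse_pair m M f xi).
Hypothesis isflow : is_flow M xi Phi.

Lemma morse_regular_flow : regular_flow M xi Phi.
Proof.
have [_ [rxi _] _ _] := fxi; split=> //.
exact: compact_quadratic.
Qed.
Let flow := morse_regular_flow.
Let rflow := regular_flow_rev flow.

Lemma orbit_curve x : M x -> curve_in M x (xi x) (Phi ^~ x).
Proof.
move=> Mx; apply/curve_inP; exists 1 => //; split.
- by move=> t _; have d := flow_derive flow t Mx; exact: (@ex_derive _ _ _ _ _ _ _ d).
- move=> t _.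
  have -> : 'D_1 (Phi ^~ x) = (fun t : R => xi (Phi t x)).
    apply/funext => s; have d := flow_derive flow s Mx.
    exact: (@derive_val _ _ _ _ _ _ _ d).
  have [_ [rxi _] _ _] := fxi.
  apply: (regular_cvg _ rxi (flow_in flow t Mx)).
    by apply: (@filterE _ (nbhs t)) => s; exact: (flow_in flow).
  have d := flow_derive flow t Mx.
  apply: (@differentiable_continuous R R 'rV[R]_n t (Phi ^~ x)).
  by apply/derivable1_diffP; exact: (@ex_derive _ _ _ _ _ _ _ d).
- by move=> t _; exact: (flow_in flow).
- exact: (flow0 flow).
- by have := flow_derive flow 0 Mx; rewrite (flow0 flow).
Qed.

(** [tderive] selects some curve. Every curve of velocity [xi x] gives [xi x *m J x], and the orbit
    is one of them, which excludes the default value 0. *)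
Lemma linearizable_chart p : critical M f p ->
  exists W Psi psi (a : 'I_m -> R),
    [/\ linear_chart M Phi p W Psi psi a,
        forall i : 'I_m, (i < morse_index m M f p)%N -> 0 < a i &
        forall i : 'I_m, (morse_index m M f p <= i)%N -> a i < 0].
Proof.
move=> cp; have [_ _ _ /(_ p cp)] := fxi.
move=> [W [Psi [psi [mu [[oW Wp] PPsi mu0 Psip lin]]]]].
pose a (i : 'I_m) := if (i < morse_index m M f p)%N then mu i else - mu i.
exists W, Psi, psi, a; split.
- split=> //; first by have [] := cp.
  move=> x Mx Wx; have [_ _ rPsi _] := PPsi.
  have [d [K [J jJ]]] := regular_jet rPsi (conj Mx Wx).
  have [d0 _ _ _ _] := jJ.
  have dcurve c : curve_in M x (xi x) c ->
      is_derive (0 : R) 1 (Psi \o c) (xi x *m J x).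
    move=> cM; have cMW := curve_in_open oW Wx cM.
    exact: curve_in_derive (curve_comp jJ (fun z _ => I : setT (Psi z)) (ballxx x d0) cMW).
  have := lin x Mx Wx; rewrite /tderive.
  case: xgetP => [D _ [c cM dc]|none]; last first.
    by have := none (xi x *m J x); case; exists (Phi ^~ x);
      [exact: orbit_curve|apply: dcurve; exact: orbit_curve].
  have DE : D = xi x *m J x by exact: is_derive_unique dc (dcurve _ cM).
  move=> E; have -> : \row_i (a i * Psi x 0 i) = xi x *m J x.
    rewrite -DE E; apply/rowP => i; rewrite !mxE /a.
    by case: ifP => // _; rewrite mulNr.
  exact: dcurve (orbit_curve Mx).
- by move=> i ij; rewrite /a ij.
- by move=> i ij; rewrite /a ltnNge ij/= oppr_lt0.
Qed.

Lemma unstableE p : unstable M Phi p = stable M (fun t => Phi (- t)) p.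
Proof.
apply/seteqP; split => x [Mx xp]; split=> //.
  exact: (cvgNy_compNP (Phi ^~ x) (nbhs p)).1 xp.
exact: (cvgNy_compNP (Phi ^~ x) (nbhs p)).2 xp.
Qed.

Lemma morse_index_le p : (morse_index m M f p <= m)%N.
Proof.
rewrite /morse_index; case: xgetP => // l -> [phi [psi [_ ->]]].
by apply/bigmax_leqP => d _; rewrite -ltnS.
Qed.

Lemma unstable_unique p q x : unstable M Phi p x -> unstable M Phi q x -> p = q.
Proof.
move=> [_ xp] [_ xq].
apply: (@cvg_unique _ _ (Phi t x @[t --> -oo])) xp xq; exact: norm_hausdorff.
Qed.

Let X l := stratum (morse_filtration m M f Phi) l.

(** Backward limits are unique, so a point of [unstable M Phi p] cannot also come from a critical
    point of smaller index. *)
Lemma unstable_stratum p : critical M f p ->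
  unstable M Phi p `<=` X (morse_index m M f p).
Proof.
move=> cp x ux; split; first by exists p.
rewrite /prev_level; case E : morse_index => [|l] //.
move=> [p' [cp' ip'] ux'].
by have := ip'; rewrite (unstable_unique ux' ux) E ltnn.
Qed.

Lemma stratum_sub l : X l `<=` M.
Proof. by move=> x [[p _ []]]. Qed.

Lemma stratum_flow l t x : X l x -> X l (Phi t x).
Proof.
have unst p s z : M z -> unstable M Phi p z -> unstable M Phi p (Phi s z).
  move=> Mz; rewrite unstableE => /(stable_flow rflow (- s) _ Mz).
  by rewrite opprK.
move=> Xx; have Mx := stratum_sub Xx; case: Xx => -[p pl px] nx; split.
  by exists p => //; exact: unst.
rewrite /prev_level in nx *; case: l pl nx => [|l] // pl nx [p' pl' px'].
apply: nx; exists p' => //.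
have := unst p' (- t) _ (flow_in flow t Mx) px'.
by rewrite (flow_add flow)// addNr (flow0 flow).
Qed.

Hypothesis MV : morse_verdier m M f Phi.

Lemma stratum_submanifold l : (l <= m)%N -> submanifold (@C2 R) l (X l).
Proof. by have [_ _ _ h _] := MV; move=> /h[]. Qed.

Lemma linear_chart_reverse p : critical M f p ->
  exists W Psi psi (a : 'I_m -> R),
    linear_chart M (fun t => Phi (- t)) p W Psi psi a /\
    forall i : 'I_m, (i < morse_index m M f p)%N -> a i < 0.
Proof.
move=> cp; have [W [Psi [psi [a [lc aP _]]]]] := linearizable_chart cp.
exists W, Psi, psi, (fun i => - a i); split; first exact: linear_chart_rev.
by move=> i /aP; rewrite oppr_lt0.
Qed.

Lemma unstable_fixed p : critical M f p -> unstable M Phi p p.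
Proof.
move=> cp; have [W [Psi [psi [a [lc aN]]]]] := linear_chart_reverse cp.
by rewrite unstableE; exact: (stable_fixed rflow lc).
Qed.

(** For the reversed flow the unstable disc is a stable one; its dimension is the index, which by
    [MV] is also that of the stratum. *)
Lemma stratum_near p : critical M f p ->
  \forall z \near p, X (morse_index m M f p) z -> unstable M Phi p z.
Proof.
move=> cp; have [W [Psi [psi [a [lc aN]]]]] := linear_chart_reverse cp.
rewrite unstableE.
apply: (stable_locally_full rflow lc (morse_index_le p) aN (@stratum_sub _)).
  by rewrite -unstableE; exact: unstable_stratum.
exact/stratum_submanifold/morse_index_le.
Qed.

Lemma tangent_unstable p x : critical M f p -> unstable M Phi p x ->
  tangent (X (morse_index m M f p)) x `<=` tangent (unstable M Phi p) x.
Proof.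
move=> cp; have [W [Psi [psi [a [lc aN]]]]] := linear_chart_reverse cp.
rewrite unstableE => ux.
apply: (tangent_stable rflow lc (morse_index_le p) aN (@stratum_sub _) _ _ _ ux).
- by rewrite -unstableE; exact: unstable_stratum.
- exact/stratum_submanifold/morse_index_le.
- by move=> t z; exact: stratum_flow.
Qed.

(** Three separate pairs of sets, so that each summand keeps its own tangency while the relation
    between velocities is transported. *)
Lemma flow_tangent_sum (T : R) x (X1 X2 X3 Y1 Y2 Y3 : set 'rV[R]_n) c1 c2 c3 v1 v2 v3 :
  [/\ X1 `<=` M, X2 `<=` M & X3 `<=` M] ->
  [/\ forall z, X1 z -> Y1 (Phi T z), forall z, X2 z -> Y2 (Phi T z) &
      forall z, X3 z -> Y3 (Phi T z)] ->
  curve_in X1 x v1 c1 -> curve_in X2 x v2 c2 -> curve_in X3 x v3 c3 ->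
  v1 = v2 + v3 -> exists w1 w2 w3,
    [/\ curve_in Y1 (Phi T x) w1 (Phi T \o c1),
        curve_in Y2 (Phi T x) w2 (Phi T \o c2),
        curve_in Y3 (Phi T x) w3 (Phi T \o c3) & w1 = w2 + w3].
Proof.
move=> [XM1 XM2 XM3] [XY1 XY2 XY3] cX1 cX2 cX3 vE.
have [w1 cw1] := flow_curve flow XM1 XY1 cX1.
have [w2 cw2] := flow_curve flow XM2 XY2 cX2.
have [w3 cw3] := flow_curve flow XM3 XY3 cX3.
exists w1, w2, w3; split=> //.
exact: (flow_curve_linear flow (curve_in_sub XM1 cX1) (curve_in_sub XM2 cX2)
  (curve_in_sub XM3 cX3) (curve_in_derive cw1) (curve_in_derive cw2) (curve_in_derive cw3) vE).
Qed.

(** Pushing forward and back restores the curve near 0; this identifies a vector brought back with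
    the original one. *)
Lemma flow_curveK (T : R) (X1 Y1 : set 'rV[R]_n) x v w c : X1 `<=` M ->
  curve_in X1 x v c ->
  curve_in Y1 (Phi (- T) (Phi T x)) w (Phi (- T) \o (Phi T \o c)) -> w = v.
Proof.
move=> XM cX cY.
have : is_derive (0 : R) 1 (Phi (- T) \o (Phi T \o c)) v.
  apply: near_eq_is_derive (curve_in_derive cX).
  have [e e0 [_ Xe _ _]] := cX; have := nbhsx_ballx (0 : R) e e0.
  apply: filterS => s /Xe /XM Ms /=.
  by rewrite (flow_add flow)// addNr (flow0 flow).
move=> dv.
exact: is_derive_unique (curve_in_derive cY) dv.
Qed.

Lemma morse_verdier_smale : morse_smale M f Phi.
Proof.
move=> p q cp cq fqp x ux sx.
pose k := morse_index m M f p; pose j := morse_index m M f q.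
have [Mx xq] := sx; have Mq : M q by have [] := cq.
have Xkx t : X k (Phi t x) by apply: stratum_flow; exact: unstable_stratum.
have uq := unstable_fixed cq.
have Xjq : X j q := unstable_stratum cq uq.
have [_ _ Fclosed _ ver] := MV.
have jk : (j <= k)%N.
  have [D cD FD] := Fclosed k (morse_index_le p).
  have Dq : D q.
    apply: (@closed_cvg _ _ (pinfty_nbhs R) _ (fun t => Phi t x) D cD _ q xq).
    apply: (@filterE _ (pinfty_nbhs R)) => t.
    by have [] := Xkx t; rewrite FD => -[].
  have : (M `&` D) q by [].
  rewrite -FD => -[p' [cp' ip'] up'].
  by rewrite /j (unstable_unique uq up').
have upx t : unstable M Phi p (Phi t x).
  by move: ux; rewrite unstableE => /(stable_flow rflow (- t) _ Mx); rewrite opprK.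
have {}jk : (j < k)%N.
  rewrite ltn_neqAle jk andbT; apply/negP => /eqP jkE.
  have nq := stratum_near cq; rewrite -/j jkE in nq.
  have [t ut] : exists t, X k (Phi t x) -> unstable M Phi q (Phi t x).
    exact: (@filter_ex _ (pinfty_nbhs R) _ _ (xq _ nq)).
  have pq := unstable_unique (upx t) (ut (Xkx t)).
  (* Here [f q < f p] excludes [p = q]. *)
  by move: fqp; rewrite pq ltxx.
have [W [Psi [psi [a [lc aP aN]]]]] := linearizable_chart cq.
(* Under the reversed flow the axes of index below [j] are contracting, hence tangent to the
   unstable disc of [q]. *)
have TX d K Q : jet (@unit_ball R m) psi 0 d K Q ->
    forall i : 'I_m, (i < j)%N -> tangent (X j) q (delta_mx 0 i *m Q 0).
  move=> jQ i ij; apply: (tangent_sub (unstable_stratum cq)).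
  have lr := linear_chart_rev lc.
  rewrite unstableE -{2}(linear_chart_psi0 lr).
  apply: (stable_disc_tangent rflow lr jQ) => //.
  - exact: unit_ball0.
  - by apply: ballxx; have [] := jQ.
  - by move=> l _; rewrite mxE.
  - move=> l; rewrite oppr_ge0 => al; rewrite mxE eqxx/=.
    case: eqP => // li; move: (aP i ij); rewrite ltNge.
    by rewrite -li al.
have km := morse_index_le p; have jm := morse_index_le q.
have [T [Tsum Tsplit]] := local_transversality flow lc aP aN
  (stratum_submanifold jm) (stratum_submanifold km) Xjq (@stratum_sub k)
  (ver j k jk km q Xjq) TX sx Xkx.
have xE : Phi (- T) (Phi T x) = x by rewrite (flow_add flow)// addNr (flow0 flow).
have uM : unstable M Phi p `<=` M by move=> z [].
have sM : stable M Phi q `<=` M by move=> z [].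
have MT (S : R) z : M z -> M (Phi S z) by exact: (flow_in flow).
(* The vectors are pushed to [Phi T x], added there by [Tsum], and the sum is brought back by
   [Phi (- T)]. *)
have Psum (v w : 'rV[R]_n) : tangent (unstable M Phi p) x v ->
  tangent (stable M Phi q) x w -> tangent M x (v + w).
  move=> [cv /(curve_in_sub uM) cvM] [cw /(curve_in_sub sM) cwM].
  have [v' cv'] := flow_curve flow (@subset_refl _ M) (MT T) cvM.
  have [w' cw'] := flow_curve flow (@subset_refl _ M) (MT T) cwM.
  have [g gM] := Tsum v' w' (ex_intro _ _ cv') (ex_intro _ _ cw').
  have [w1 [w2 [w3 [cw1 cw2 cw3 wE]]]] := flow_tangent_sum
    (And3 (@subset_refl _ M) (@subset_refl _ M) (@subset_refl _ M))
    (And3 (MT (- T)) (MT (- T)) (MT (- T))) gM cv' cw' erefl.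
  rewrite -(flow_curveK (@subset_refl _ M) cvM cw2).
  rewrite -(flow_curveK (@subset_refl _ M) cwM cw3) -wE -xE.
  by exists (Phi (- T) \o g).
apply/seteqP; split=> [_ [v Tv [w Tw <-]]|v [c cM]].
  exact: Psum.
have [v' cM'] := flow_curve flow (@subset_refl _ M) (MT T) cM.
have [v1 [v2 [Tv1 Tv2 vE]]] := Tsplit v' (ex_intro _ _ cM').
(* [Tv1] only concerns the stratum; transport back to [x] requires a curve in the unstable set of
   [p] itself. *)
have [c1 cM1] := tangent_unstable cp (upx T) Tv1.
have [c2 cM2] := Tv2.
have uT z : unstable M Phi p z -> unstable M Phi p (Phi (- T) z).
  by move=> uz; have := uz; rewrite unstableE => /(stable_flow rflow T _ (uM _ uz)).
have sT z : stable M Phi q z -> stable M Phi q (Phi (- T) z).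
  by move=> sz; apply/(stable_flow flow (- T) _ (sM _ sz)).
have [w1 [w2 [w3 [cw1 cw2 cw3 wE]]]] := flow_tangent_sum
  (And3 (@subset_refl _ M) uM sM)
  (And3 (MT (- T)) uT sT) cM' cM1 cM2 vE.
have <- : w1 = v := flow_curveK (@subset_refl _ M) cM cw1.
exists w2; first by rewrite -xE; exists (Phi (- T) \o c1).
by exists w3; [rewrite -xE; exists (Phi (- T) \o c2)|].
Qed.

End MorseFlows.

Theorem theorem8p1 (R : realType) (n m : nat) (M : set 'rV[R]_n)
    (f : 'rV[R]_n -> R) (xi : 'rV[R]_n -> 'rV[R]_n)
    (Phi : R -> 'rV[R]_n -> 'rV[R]_n)
    (Mcompact : compact M) (Mconnected : connected M)
    (Manalytic : submanifold (@analytic R) m M)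
    (fxi : morse_pair m M f xi) (flow : is_flow M xi Phi)
    (MV : morse_verdier m M f Phi) :
  morse_smale M f Phi.
Proof. exact: morse_verdier_smale Mcompact fxi flow MV. Qed.
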